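(* Let $l\ge 1$. (i) For all partitions $\mu=(\mu_1,\dots,\mu_l)$ and $\lambda=(\lambda_1,\dots,\lambda_l)$ one has $\langle\mu|\lambda\rangle=\delta_{\lambda\mu}$. (ii) For all generalized partitions $\mu=(\mu_1,\dots,\mu_l)$ and $\lambda=(\lambda_1,\dots,\lambda_l)$ one has $\langle\mu^{\rm sp}|\lambda^{\rm sp}\rangle=\delta_{\lambda\mu}$. (iii) For all generalized partitions $\mu=(\mu_1,\dots,\mu_l)$ and $\lambda=(\lambda_1,\dots,\lambda_l)$ one has $\langle\mu^{\rm o}|\lambda^{\rm o}\rangle=\delta_{\lambda\mu}$. Here $\delta_{\lambda\mu}$ is $1$ if $\lambda=\mu$ and $0$ otherwise.
   Context: A partition is a finite weakly decreasing sequence of positive integers; a generalized partition $\lambda=(\lambda_1,\dots,\lambda_n)$ is a finite weakly decreasing sequence of nonnegative integers (zeros allowed, and the number $n$ of entries is part of the data). Fock spaces. Let $\mathcal H$ be the Heisenberg algebra generated by $a_n$ ($n\in\mathbb Z\setminus\{0\}$) with $[a_m,a_n]=m\delta_{m,-n}$. Let $\mathcal M$ be the left $\mathcal H$-module generated by $|0\rangle$ with $a_n|0\rangle=0$ for $n>0$ (so $\mathcal M\cong\mathbb C[a_{-1},a_{-2},\dots]$), and $\mathcal M^*$ the right $\mathcal H$-module generated by $\langle 0|$ with $\langle 0|a_{-n}=0$ for $n>0$ (so $\mathcal M^*\cong\mathbb C[a_1,a_2,\dots]$, graded by $\deg a_n=n$). $\widetilde{\mathcal M^*}$ is the completion of $\mathcal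 M^*$ with respect to the filtration by subspaces spanned by homogeneous elements of degree $\ge n$. The pairing $\langle u|v\rangle$ of $\langle u|\in\widetilde{\mathcal M^*}$ and $|v\rangle\in\mathcal M$ is determined by $\langle 0|0\rangle=1$ and $\langle uA|v\rangle=\langle u|Av\rangle$ for operators $A$. Vertex operators (formal series in $z$): $X(z)=\exp\big(\sum_{n\ge1}\frac{a_{-n}}{n}z^n\big)\exp\big(-\sum_{n\ge1}\frac{a_n}{n}z^{-n}\big)=\sum_{n\in\mathbb Z}X_nz^{-n}$, $X^*(z)=\exp\big(-\sum_{n\ge1}\frac{a_{-n}}{n}z^n\big)\exp\big(\sum_{n\ge1}\frac{a_n}{n}z^{-n}\big)=\sum_{n\in\mathbb Z}X^*_nz^{n}$, $Y(z)=\exp\big(\sum_{n\ge1}\frac{a_{-n}}{n}z^n\big)\exp\big(-\sum_{n\ge1}\frac{a_n}{n}(z^{-n}+z^n)\big)=\sum_{n\in\mathbb Z}Y_nz^{-n}$, $Y^*(z)=(1-z^2)\exp\big(-\sum_{n\ge1}\frac{a_{-n}}{n}z^n\big)\exp\big(\sum_{n\ge1}\frac{a_n}{n}(z^{-n}+z^n)\big)=\sum_{n\in\mathbb Z}Y^*_nz^{n}$, $W(z)=(1-z^2)\exp\big(\sum_{n\ge1}\frac{a_{-n}}{n}z^n\big)\exp\big(-\sum_{n\ge1}\frac{a_n}{n}(z^{-n}+z^n)\big)=\sum_{n\in\mathbb Z}W_nz^{-n}$, $W^*(z)=\exp\big(-\sum_{n\ge1}\frac{a_{-n}}{n}z^n\big)\exp\big(\sum_{n\ge1}\frac{a_n}{n}(z^{-n}+z^n)\big)=\sum_{n\in\mathbb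 Z}W^*_nz^{n}$. For $\lambda=(\lambda_1,\dots,\lambda_l)$: $|\lambda\rangle=X_{-\lambda_1}\cdots X_{-\lambda_l}|0\rangle$, $\langle\lambda|=\langle0|X^*_{-\lambda_l}\cdots X^*_{-\lambda_1}$; $|\lambda^{\rm sp}\rangle=Y_{-\lambda_1}\cdots Y_{-\lambda_l}|0\rangle$, $\langle\lambda^{\rm sp}|=\langle0|Y^*_{-\lambda_l}\cdots Y^*_{-\lambda_1}$; $|\lambda^{\rm o}\rangle=W_{-\lambda_1}\cdots W_{-\lambda_l}|0\rangle$, $\langle\lambda^{\rm o}|=\langle0|W^*_{-\lambda_l}\cdots W^*_{-\lambda_1}$. The vectors $\langle\lambda^{\rm sp}|,\langle\lambda^{\rm o}|$ lie in $\widetilde{\mathcal M^*}$. *)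

(* Defs.v *)
From HB Require Import structures.
From mathcomp Require Import all_boot all_order all_algebra finmap.
From mathcomp Require Import boolp classical_sets functions fsbigop reals.
From mathcomp.multinomials Require Import monalg.

Set Implicit Arguments.
Unset Strict Implicit.
Unset Printing Implicit Defensive.

Import Order.TTheory GRing.Theory Num.Theory.
Local Open Scope ring_scope.

(* A monomial m : mono stands for prod_k a_{-(k+1)}^(m k) (or, in the dual     *)
(* module, prod_k a_{k+1}^(m k)): the variable of index k : nat is a_{-(k+1)}, *)
(* resp. a_{k+1}, so that no variable a_0 occurs.                              *)
Notation mono := {cmonom nat}.

(* M = K[a_{-1}, a_{-2}, ...] *)
Notation fock K := {malg K[mono]}.

(* The completion of M^* = K[a_1, a_2, ...] by degree (deg a_n = n). There are *)
(* finitely many monomials of each degree, so its elements are the arbitrary   *)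
(* families of coefficients indexed by monomials.                              *)
Notation cfock K := (mono -> K^o).

Definition vac (K : numFieldType) : fock K := << 1 *g mone >>.

Definition covac (K : numFieldType) : cfock K := fun m => (m == mone)%:R.

(* Left action of a_n on M: a_{-(k+1)} multiplies and a_{k+1} is               *)
(* (k+1) d/da_{-(k+1)}. Note that Negz k is -(k+1); the Heisenberg algebra has *)
(* no generator a_0, and the value at 0 is a dummy.                            *)
Definition act (K : numFieldType) (n : int) (v : fock K) : fock K :=
  match n with
  | Posz 0 => 0
  | Posz k.+1 =>
      \sum_(m <- msupp v) << v@_m * (k.+1 * m k)%:R *g divcm m (ucm k) >>
  | Negz k => << ucm k >> * v
  end.

(* Right action of a_n on the completed dual: ract n u is u a_n. Here a_{k+1}  *)
(* multiplies and a_{-(k+1)} is (k+1) d/da_{k+1}.                              *)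
Definition ract (K : numFieldType) (n : int) (u : cfock K) : cfock K :=
  match n with
  | Posz 0 => 0
  | Posz k.+1 => fun m => if m k == 0%N then 0 else u (divcm m (ucm k))
  | Negz k => fun m => (k.+1 * (m k).+1)%:R * u (mmul m (ucm k))
  end.

Definition pairing (K : numFieldType) (u : cfock K) (v : fock K) : K :=
  \sum_(m <- msupp v)
     u m * v@_m * (\prod_(k <- finsupp m) (k.+1 ^ m k * (m k)`!))%:R.

Section FockSpace.
Context (K : numFieldType).
Implicit Types (u : cfock K) (v : fock K) (m : mono) (k : nat) (i j n : int).

Lemma divmU m k : divcm (mmul m (ucm k)) (ucm k) = m.
Proof. by apply/eqP/cmP => j; rewrite divcmE cmM addnK. Qed.

Lemma mulDU m k : m k != 0%N -> mmul (divcm m (ucm k)) (ucm k) = m.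
Proof.
move=> mk; apply/eqP/cmP => j; rewrite cmM divcmE cmU subnK//.
by case: eqP => // <-; rewrite lt0n.
Qed.

Lemma act_posE k v m :
  (act k.+1%:Z v)@_m = (k.+1 * (m k).+1)%:R * v@_(mmul m (ucm k)).
Proof.
rewrite /act raddf_sum/=.
under eq_bigr do rewrite mcoeffU.
have [mv|mv] := boolP (mmul m (ucm k) \in msupp v); last first.
  rewrite [v@__]mcoeff_outdom// mulr0 big1_seq// => m' /andP[_ m'v].
  case: eqP => // e; have [m'k|m'k] := eqVneq (m' k) 0%N.
    by rewrite m'k muln0 mulr0 mulr1n.
  by move: mv; rewrite -e mulDU// m'v.
rewrite (big_rem _ mv)/= divmU eqxx mulr1n cmM cmUU addn1 mulrC.
rewrite big1_seq ?addr0// => m' /andP[_ ]; rewrite mem_rem_uniq ?fset_uniq// inE.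
move=> /andP[m'n _]; case: eqP => // e.
have [m'k|m'k] := eqVneq (m' k) 0%N; first by rewrite m'k muln0 mulr0 mulr1n.
by move: m'n; rewrite -e mulDU// eqxx.
Qed.

Lemma act_negE k v m :
  (act (Negz k) v)@_m = if m k == 0%N then 0 else v@_(divcm m (ucm k)).
Proof.
rewrite /act malgM_def fgmulUg raddf_sum/=.
under eq_bigr do rewrite mul1r mcoeffU.
case: eqP => [mk|/eqP mk].
  apply: big1 => m' _; case: eqP => // e.
  by move: mk; rewrite -e cmM cmUU.
have [mv|mv] := boolP (divcm m (ucm k) \in msupp v); last first.
  rewrite [v@__]mcoeff_outdom// big1_seq// => m' /andP[_ m'v].
  by case: eqP => // e; move: mv; rewrite -e mulmC divmU m'v.
rewrite (big_rem _ mv)/= mulmC mulDU// eqxx mulr1n.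
rewrite big1_seq ?addr0// => m' /andP[_ ]; rewrite mem_rem_uniq ?fset_uniq// inE.
move=> /andP[m'n _]; case: eqP => // e.
by move: m'n; rewrite -e mulmC divmU eqxx.
Qed.

Lemma act_coef n v m : (act n v)@_m = ract (- n) (fun m => v@_m) m.
Proof.
by case: n => [[|k]|k]; [rewrite oppr0 mcoeff0|rewrite act_posE|rewrite act_negE].
Qed.


(* The two actions satisfy the Heisenberg relations. *)
Lemma ract_comm i j u : i != 0 -> j != 0 ->
  ract j (ract i u) - ract i (ract j u) = (i *+ (i + j == 0))%:~R *: u.
Proof.
have UM k l m : mmul (mmul m (ucm k)) (ucm l) = mmul (mmul m (ucm l)) (ucm k).
  by rewrite -!mulmA (mulmC (ucm k)).
have UD k l m : divcm (divcm m (ucm k)) (ucm l) = divcm (divcm m (ucm l)) (ucm k).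
  by apply/eqP/cmP => x; rewrite !divcmE subnAC.
have UMD k l m : k != l ->
    mmul (divcm m (ucm k)) (ucm l) = divcm (mmul m (ucm l)) (ucm k).
  move=> kl; apply/eqP/cmP => x; rewrite !(cmM, divcmE) !cmU.
  have [<-|_] := eqVneq k x; last by rewrite !subn0.
  by rewrite eq_sym (negbTE kl) !addn0.
have pn k l w : ract (Negz l) (ract k.+1%:Z w) - ract k.+1%:Z (ract (Negz l) w)
    = (k.+1%:Z *+ (k == l))%:~R *: w.
  apply/funext => m; rewrite -[LHS]/(_ m - _ m) -[RHS]/(_ * w m) /=.
  have [<-|kl] := eqVneq k l.
    rewrite cmM cmUU addn1/= divmU divcmE cmUU mulr1n.
    have [mk|mk] := eqVneq (m k) 0%N; first by rewrite mk subr0 muln1.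
    rewrite mulDU// subn1 prednK ?lt0n// -mulrBl -natrB ?leq_mul2l ?leqnSn ?orbT//.
    by rewrite -mulnBr subSnn muln1.
  rewrite mulr0n mul0r cmM cmU (eq_sym l k) (negbTE kl) addn0.
  case: ifP => _; first by rewrite mulr0 subrr.
  by rewrite divcmE cmU (negbTE kl) subn0 UMD// subrr.
case: i j => [[|k]|k] [[|l]|l]// _ _.
- rewrite -PoszD addSn /= mulr0n scale0r; apply/funext => m; rewrite -[LHS]/(_ m - _ m) -[RHS]/(0 : K) /=.
  rewrite !divcmE !cmU (UD k l) (eq_sym l k).
  have [<-|kl] := eqVneq k l; first by rewrite subrr.
  by rewrite !subn0; do !case: ifP => _; rewrite subrr.
- rewrite pn; congr ((_ *+ _)%:~R *: _).
  by rewrite NegzE subr_eq0 eqz_nat eqSS.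
- rewrite -opprB pn NegzE addrC subr_eq0 eqz_nat eqSS -scaleNr; congr (_ *: _).
  by rewrite eq_sym; case: eqP => [->|]; rewrite ?mulr0n ?mulr1n ?oppr0// rmorphN.
- rewrite !NegzE -opprD oppr_eq0 -PoszD addSn /= mulr0n scale0r.
  apply/funext => m; rewrite -[LHS]/(_ m - _ m) -[RHS]/(0 : K) /=.
  rewrite !cmM !cmU (UM k l) (eq_sym l k).
  have [<-|kl] := eqVneq k l; first by rewrite subrr.
  by rewrite !addn0 mulrCA subrr.
Qed.

Lemma act_comm i j v : i != 0 -> j != 0 ->
  act i (act j v) - act j (act i v) = (i *+ (i + j == 0))%:~R *: v.
Proof.
move=> i0 j0; apply/malgP => m.
have actE n w : (fun m => (act n w)@_m) = ract (- n) (fun m => w@_m) :> cfock K.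
  by apply/funext => m'; rewrite act_coef.
rewrite mcoeffB mcoeffZ !act_coef !actE.
have := congr1 (@^~ m) (@ract_comm (- i) (- j) (fun m => v@_m) _ _).
rewrite !oppr_eq0 => /(_ i0 j0); rewrite -[X in X = _ -> _]/(_ m - _ m) -[X in _ = X -> _]/(_ * v@_m) => e.
apply: oppr_inj; rewrite opprB [LHS]e -opprD oppr_eq0.
by rewrite mulNrn rmorphN mulNr.
Qed.

Lemma act_vac n : 0 < n -> act n (vac K) = 0.
Proof.
case: n => [[|k]|k]// _; apply/malgP => m.
by rewrite act_posE mcoeffU eq_sym mcoeff0 cmM_eq1 cm1_eq1 andbF mulr0.
Qed.

Lemma ract_covac n : n < 0 -> ract n (covac K) = 0.
Proof.
case: n => [[|k]|k]// _; apply/funext => m.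
by rewrite /= /covac cmM_eq1 cm1_eq1 andbF mulr0.
Qed.

(* The two defining properties of the pairing: pairing_vac and pairing_act. *)
Lemma pairing_vac : pairing (covac K) (vac K) = 1.
Proof.
rewrite /pairing msuppU oner_eq0 big_seq_fset1 mcoeffUU mdom1 big_seq_fset0.
by rewrite /covac eqxx !mulr1.
Qed.

Lemma pairing_act n u v : pairing (ract n u) v = pairing u (act n v).
Proof.
pose N m := (\prod_(k <- finsupp m) (k.+1 ^ m k * (m k)`!))%N.
have pairw (w : cfock K) (t : fock K) (d : {fset mono}) : (msupp t `<=` d)%fset ->
    pairing w t = \sum_(m <- d) w m * t@_m * (N m)%:R.
  move=> td; rewrite /pairing (big_fset_incl _ td)// => m _ mt.
  by rewrite mcoeff_outdom// mulr0 mul0r.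
have pairD (w : cfock K) (t t' : fock K) : pairing w (t + t') = pairing w t + pairing w t'.
  rewrite (@pairw w _ _ (msuppD_le t t')) (@pairw w t _ (fsubsetUl _ (msupp t'))).
  rewrite (@pairw w t' _ (fsubsetUr (msupp t) _)) -big_split/=.
  by apply: eq_bigr => m _; rewrite mcoeffD mulrDr mulrDl.
have pair0 (w : cfock K) : pairing w (0 : fock K) = 0.
  by rewrite /pairing msupp0 big_seq_fset0.
have pairS (w : cfock K) (r : seq mono) (F : mono -> fock K) :
    pairing w (\sum_(m <- r) F m) = \sum_(m <- r) pairing w (F m).
  by apply: (big_morph (pairing w)) => // t t'; exact: pairD.
have pairU (w : cfock K) (c : K) m : pairing w << c *g m >> = w m * c * (N m)%:R.
  by rewrite (@pairw w _ _ msuppU_le) big_seq_fset1 mcoeffUU.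
have NM m k : N (mmul m (ucm k)) = (k.+1 * (m k).+1 * N m)%N.
  have Nw m' (d : {fset nat}) : (finsupp m' `<=` d)%fset ->
      N m' = (\prod_(k <- d) (k.+1 ^ m' k * (m' k)`!))%N.
    move=> md; rewrite /N (big_fset_incl _ md)// => x _.
    by rewrite -cmE_eq0 => /eqP ->.
  have kd : k \in finsupp (mmul m (ucm k)) by rewrite mdomD mdomU !inE eqxx orbT.
  rewrite (Nw m (finsupp (mmul m (ucm k)))) ?mdomD ?fsubsetUl// -mdomD.
  rewrite /N !(big_rem k kd)/= cmM cmUU addn1 expnS factS.
  rewrite [X in (_ * X)%N = _](_ : _ = \prod_(y <- rem k (finsupp (mmul m (ucm k))))
      (y.+1 ^ m y * (m y)`!))%N; first by rewrite !mulnA; congr (_ * _ * _)%N; exact: mulnAC.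
  apply: eq_big_seq => x; rewrite mem_rem_uniq ?fset_uniq// inE => /andP[xk _].
  by rewrite cmM cmU eq_sym (negbTE xk) addn0.
case: n => [[|k]|k] /=.
- by rewrite pair0 /pairing big1// => m _; rewrite !mul0r.
- rewrite pairS; apply: eq_bigr => m _; rewrite pairU.
  have [mk|mk] := eqVneq (m k) 0%N; first by rewrite mk muln0 mulr0 !(mulr0, mul0r).
  rewrite -[in (\prod_(_ <- _) _)%N](mulDU mk) -/(N _) NM divcmE cmUU subn1.
  by rewrite prednK ?lt0n// natrM !mulrA.
- rewrite malgM_def fgmulUg pairS; apply: eq_bigr => m _.
  rewrite pairU mul1r (mulmC (ucm k)) NM -/(N m).
  by rewrite [in RHS]natrM mulrA; congr (_ * _); rewrite -mulrA mulrC.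
Qed.
End FockSpace.

(* Sums of summable families in M and in the completed dual. In the latter     *)
(* convergence means that each coefficient receives finitely many nonzero      *)
(* contributions. The families below are summable: in M, operators a_n with    *)
(* n > 0 are locally nilpotent; in the dual, multiplying by a_n, n > 0, raises *)
(* the degree by n. (Should summability fail, \sum_(i \in D) would return 0.)  *)
Definition fsum (K : numFieldType) (I : choiceType) (D : set I)
  (f : I -> fock K) : fock K := (\sum_(i \in D) f i)%R.
Definition cfsum (K : numFieldType) (I : choiceType) (D : set I)
  (f : I -> cfock K) : cfock K := fun m => (\sum_(i \in D) f i m)%R.

(* Formal series with operator coefficients: S k is the coefficient of z^k,    *)
(* for k : int.                                                                *)
Definition opser (V : Type) : Type := int -> V -> V.

Definition summation (V : Type) : Type :=
  forall I : choiceType, set I -> (I -> V) -> V.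

(* exp(B(z)) = sum_j B(z)^j / j!, expanded over the sequences of exponents     *)
(* s = [:: k_1; ...; k_j], of total k for the coefficient of z^k. As reversal  *)
(* permutes these sequences, the formula holds for left and right actions.     *)
Definition expser (K : numFieldType) (V : lmodType K) (sum : summation V)
    (B : opser V) : opser V :=
  fun k v => sum _ [set s : seq int | \sum_(i <- s) i = k]%classic
               (fun s => ((size s)`!)%:R^-1 *: foldr B v s).

(* Coefficients of A(z) B(z) acting on the left, resp. on the right. *)
Definition mulser (V : Type) (sum : summation V) (A B : opser V) : opser V :=
  fun k v => sum _ [set: int]%classic (fun i => A i (B (k - i) v)).
Definition rmulser (V : Type) (sum : summation V) (A B : opser V) : opser V :=
  fun k u => sum _ [set: int]%classic (fun i => B (k - i) (A i u)).

(* (1 - z^2) S(z) *)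
Definition mul1z2 (V : zmodType) (S : opser V) : opser V :=
  fun k v => S k v - S (k - 2) v.

(* c sum_{n>=1} a_{-n}/n z^n,  c sum_{n>=1} a_n/n z^{-n}  and                  *)
(* c sum_{n>=1} a_n/n (z^{-n} + z^n),  where a n is the operator a_n.          *)
Definition crexp (K : numFieldType) (V : lmodType K) (a : int -> V -> V)
    (c : K) : opser V :=
  fun k v => if 0 < k then (c / k%:~R) *: a (- k) v else 0.
Definition anexp (K : numFieldType) (V : lmodType K) (a : int -> V -> V)
    (c : K) : opser V :=
  fun k v => if k < 0 then (c / (- k)%:~R) *: a (- k) v else 0.
Definition symexp (K : numFieldType) (V : lmodType K) (a : int -> V -> V)
    (c : K) : opser V :=
  fun k v => if k != 0 then (c / `|k|%:~R) *: a `|k| v else 0.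

Section VertexOperators.
Context (K : numFieldType).

Local Notation exp := (expser (@fsum K)).
Local Notation rexp := (expser (V := cfock K) (@cfsum K)).

(* X(z), Y(z), W(z) acting on M, and X^*(z), Y^*(z), W^*(z) acting on the      *)
(* right of the completed dual.                                                *)
Definition Xser : opser (fock K) :=
  mulser (@fsum K) (exp (crexp (@act K) 1)) (exp (anexp (@act K) (- 1))).
Definition Xsser : opser (cfock K) :=
  rmulser (@cfsum K) (rexp (crexp (@ract K) (- 1))) (rexp (anexp (@ract K) 1)).

Definition Yser : opser (fock K) :=
  mulser (@fsum K) (exp (crexp (@act K) 1)) (exp (symexp (@act K) (- 1))).
Definition Ysser : opser (cfock K) :=
  mul1z2 (rmulser (@cfsum K) (rexp (crexp (@ract K) (- 1)))
                             (rexp (symexp (@ract K) 1))).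

Definition Wser : opser (fock K) :=
  mul1z2 (mulser (@fsum K) (exp (crexp (@act K) 1))
                           (exp (symexp (@act K) (- 1)))).
Definition Wsser : opser (cfock K) :=
  rmulser (@cfsum K) (rexp (crexp (@ract K) (- 1))) (rexp (symexp (@ract K) 1)).

(* X(z) = sum_n X_n z^{-n} but X^*(z) = sum_n X^*_n z^n, and so on. *)
Definition Xop (n : int) : fock K -> fock K := Xser (- n).
Definition Xsop (n : int) : cfock K -> cfock K := Xsser n.
Definition Yop (n : int) : fock K -> fock K := Yser (- n).
Definition Ysop (n : int) : cfock K -> cfock K := Ysser n.
Definition Wop (n : int) : fock K -> fock K := Wser (- n).
Definition Wsop (n : int) : cfock K -> cfock K := Wsser n.

(* ket T [:: p1; ...; pl] = T_{-p1} ... T_{-pl} |0>. *)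
Definition ket (T : int -> fock K -> fock K) (s : seq nat) : fock K :=
  foldr (fun (p : nat) v => T (- p%:Z) v) (vac K) s.

(* bra T [:: p1; ...; pl] = <0| T_{-pl} ... T_{-p1}: on the right, the         *)
(* operator of index -pl acts first, hence the foldr here too.                 *)
Definition bra (T : int -> cfock K -> cfock K) (s : seq nat) : cfock K :=
  foldr (fun (p : nat) u => T (- p%:Z) u) (covac K) s.

Definition ketX := ket Xop.
Definition braX := bra Xsop.
Definition ketSp := ket Yop.
Definition braSp := bra Ysop.
Definition ketO := ket Wop.
Definition braO := bra Wsop.

End VertexOperators.

Definition is_genpart (s : seq nat) : bool := sorted geq s.
Definition is_part (s : seq nat) : bool := sorted geq s && (0%N \notin s).

(* Main.v *)
From HB Require Import structures.
Require Import Defs.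
From mathcomp Require Import all_boot all_order all_algebra reals complex.
From mathcomp Require Import finmap boolp classical_sets functions fsbigop.
From mathcomp.multinomials Require Import monalg.
From mathcomp Require Import zify ring.

Set Implicit Arguments.
Unset Strict Implicit.
Unset Printing Implicit Defensive.

Import Order.TTheory GRing.Theory Num.Theory.
Local Open Scope ring_scope.

(** The pairing of a bra with a ket is a vacuum expectation value: by
    adjunction the right operators of the bra become operators acting on the
    left of M, and the pairing equals
      <0| T'_{-mu_l} ... T'_{-mu_1} T_{lam_1} ... T_{lam_l} |0>,
    where T_k is the coefficient of z^k in X(z), Y(z) or W(z) and T'_k the
    coefficient of w^k in the starred series, now acting on M.

    The three families obey one and the same fermionic relation
      T'_b T_a + T_{a+1} T'_{b-1} = delta_{a+b,0},
    together with T'_b |0> = 0 for b < 0, and this is all that orthonormality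
    needs (orthonormal). Moving T'_{-mu_1} to the right past the first i
    operators T turns it into T'_{-mu_1-i} and raises these i parts by 1. It
    can be absorbed by the next part if lam_{i+1} = mu_1 + i; otherwise it goes
    on, and the vacuum kills it in the end. For i >= 1 the ket left over is
    again weakly decreasing, and its first part lam_1 + 1 is larger than mu_2,
    so that by induction on l it is orthogonal to the bra of (mu_2, ..., mu_l)
    (commute_past). Only the term i = 0 survives; it asks lam_1 = mu_1 and
    leaves the pairing of the tails.

    The fermionic relation (vtx_anticommutation) is usually read off from
    normal ordering and partial fractions. It is proved here from commutators
    with the Heisenberg algebra. For each n <> 0 there are scalars p, q with
      T(z) a_n = (a_n + p z^n + q z^{-n}) T(z),
      T'(w) a_n = (a_n - p w^n - q w^{-n}) T'(w),
    and (p z^n + q z^{-n} - p w^n - q w^{-n}) delta(z/w) = 0, so both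
    sides of the relation have the same commutators with all the a_n. Families
    of operators with such commutators are determined by their vacuum
    expectation values (birel_eq0): M is generated from |0> by the a_{-n}, and
    an element of M that all the a_n, n > 0, annihilate is a constant. What
    remains is an identity between the coefficients of <0|T'(w) T(z)|0> and
    <0|T(z) T'(w)|0>. For X the first is 1/(1 - z/w), expanded in z, and for Y
    and W it is 1/((1 - zw)(1 - z/w)) times 1 - w^2 or 1 - z^2; in the second, z
    and w are exchanged in the denominators. These values follow from the
    Newton recursion for the coefficients h_k of exp(c sum_n a_{-n}/n z^n) |0>,
    which reads k h_k = c sum_n a_{-n} h_{k-n} (vev_rec, vev_chi).

    The series are infinite sums. On a given vector, or at a given monomial of
    the dual, only the words in a bounded box contribute to an exponential, so
    that each coefficient agrees with a truncated exponential (expserE,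
    cexpserE), and commutators and adjoints are computed on truncations. *)

(** * Linear maps *)

Section Linear.
Context (K : numFieldType) (U V : lmodType K) (f : U -> V).
Hypothesis lf : linear f.

Lemma lin0 : f 0 = 0.
Proof. by have := lf (- 1) 0 0; rewrite scaler0 addr0 scaleN1r addNr. Qed.

Lemma linD u v : f (u + v) = f u + f v.
Proof. by have := lf 1 u v; rewrite !scale1r. Qed.

Lemma linZ a u : f (a *: u) = a *: f u.
Proof. by have := lf a u 0; rewrite lin0 !addr0. Qed.

Lemma linN u : f (- u) = - f u.
Proof. by rewrite -scaleN1r linZ scaleN1r. Qed.

Lemma linB u v : f (u - v) = f u - f v.
Proof. by rewrite linD linN. Qed.

Lemma lin3 x a y b z : f (x + a *: y + b *: z) = f x + a *: f y + b *: f z.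
Proof. by rewrite !linD !linZ. Qed.

Lemma lin5 x a1 y1 a2 y2 a3 y3 a4 y4 :
  f (x + a1 *: y1 + a2 *: y2 + a3 *: y3 + a4 *: y4) =
  f x + a1 *: f y1 + a2 *: f y2 + a3 *: f y3 + a4 *: f y4.
Proof. by rewrite !linD !linZ. Qed.

Lemma lin_sum I (r : seq I) (P : pred I) F :
  f (\sum_(i <- r | P i) F i) = \sum_(i <- r | P i) f (F i).
Proof. exact: (big_morph f linD lin0). Qed.

End Linear.

(** * Finitely supported sums over integers and words *)

Definition ints (d : nat) : seq int := [seq i%:Z - d%:Z | i <- iota 0 d.*2.+1].
Arguments ints : simpl never.

Lemma mem_ints d (x : int) : (x \in ints d) = (`|x| <= d)%N.
Proof.
apply/mapP/idP => [[j]|xd]; first by rewrite mem_iota => ? ->; lia.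
by exists (absz (x + d%:Z)); [rewrite mem_iota|]; lia.
Qed.

Lemma ints_uniq d : uniq (ints d).
Proof. by rewrite map_inj_uniq ?iota_uniq// => i j; lia. Qed.

Section FiniteSums.
Context (V : zmodType).

Lemma sum_ints_fs d (f : int -> V) : (forall i, f i != 0 -> (`|i| <= d)%N) ->
  (\sum_(i \in [set: int]%classic) f i)%R = \sum_(i <- ints d) f i.
Proof.
move=> fd; rewrite (fsbigE (ints d))//; last first.
- move=> i _; rewrite mem_ints => di; apply/eqP; apply: contraNT di; exact: fd.
- exact: ints_uniq.
by apply: eq_bigl => i; rewrite in_setT.
Qed.

Lemma sum_ints_shift d (j : int) (f : int -> V) :
  (forall i, f i != 0 -> (`|i| <= d)%N) ->
  \sum_(i <- ints (d + `|j|)) f (i - j) = \sum_(i <- ints d) f i.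
Proof.
move=> fd; rewrite -(sum_ints_fs fd) (reindex_fsbigT (fun i => i - j)).
  by rewrite -sum_ints_fs// => i /fd; lia.
by exists (fun i => i + j) => i; rewrite ?addrK ?subrK.
Qed.

Lemma sum_ints1 d (j : int) (f : int -> V) : (`|j| <= d)%N ->
  (forall i, i != j -> f i = 0) -> \sum_(i <- ints d) f i = f j.
Proof.
by move=> jd fj; rewrite (bigD1_seq j) ?mem_ints ?ints_uniq//= big1 ?addr0.
Qed.
End FiniteSums.

Fixpoint words (d n : nat) : seq (seq int) :=
  if n is n'.+1 then [seq x :: s | x <- ints d, s <- words d n'] else [:: [::]].

Lemma mem_words d n s :
  (s \in words d n) = (size s == n) && all (fun x : int => `|x| <= d)%N s.
Proof.
elim: n s => [|n IH] s; first by rewrite inE; case: s.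
apply/allpairsP/idP => [[[x t]/= [xd tw ->]]|]; last case: s => // x s.
  by rewrite /= eqSS -mem_ints xd; move: tw; rewrite IH.
rewrite /= eqSS => /and3P[sn xd sd]; exists (x, s) => /=.
by rewrite IH sn mem_ints.
Qed.

Lemma words_uniq d n : uniq (words d n).
Proof.
elim: n => // n IH; rewrite allpairs_uniq ?ints_uniq// => -[x s] [y t] _ _ /=.
by case=> -> ->.
Qed.

(** * Truncated exponentials of operator series *)

Section TruncatedExp.
Context (K : numFieldType) (V : lmodType K) (B : int -> V -> V).
Hypothesis lB : forall i, linear (B i).

(** The coefficient of z^k in B(z)^n, where each factor B(z) is cut to the
    exponents in [-d, d]. *)
Fixpoint powser (d n : nat) (k : int) (v : V) : V :=
  if n is n'.+1 then \sum_(i <- ints d) B i (powser d n' (k - i) v)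
  else if k == 0 then v else 0.

Definition texp (d N : nat) (k : int) (v : V) : V :=
  \sum_(n < N) (n`!)%:R^-1 *: powser d n k v.

Lemma powser_linear d n k : linear (powser d n k).
Proof.
elim: n k => [|n IH] k a u v /=; first by case: ifP; rewrite ?scaler0 ?addr0.
rewrite scaler_sumr -big_split/=; apply: eq_bigr => i _.
by rewrite IH lB.
Qed.

Lemma texp_linear d N k : linear (texp d N k).
Proof.
move=> a u v; rewrite scaler_sumr -big_split/=; apply: eq_bigr => i _.
by rewrite powser_linear scalerDr !scalerA mulrC.
Qed.

(** The factor split off on the right instead of the left; adjunction exchanges
    the two. *)
Lemma powserSr d n k v :
  powser d n.+1 k v = \sum_(i <- ints d) powser d n (k - i) (B i v).
Proof.
elim: n k => [|n IH] k.
  rewrite /=; apply: eq_bigr => i _; case: ifP => // _; exact: lin0.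
transitivity (\sum_(i <- ints d) B i (powser d n.+1 (k - i) v)) => //.
under eq_bigr do rewrite IH (lin_sum (lB _)).
rewrite exchange_big/=; apply: eq_bigr => j _; apply: eq_bigr => i _.
by congr (B i (powser _ _ _ _)); ring.
Qed.

Lemma powserE d n k v : powser d n k v =
  \sum_(s <- words d n | \sum_(i <- s) i == k) foldr B v s.
Proof.
elim: n k => [|n IH] k.
  by rewrite /= big_mkcond big_seq1 big_nil eq_sym; case: ifP.
rewrite [LHS]/= [RHS]big_mkcond.
rewrite -[words _ _]/[seq x :: s | x <- ints d, s <- words d n].
rewrite big_allpairs_dep; apply: eq_bigr => i _.
rewrite IH (lin_sum (lB _)) [LHS]big_mkcond; apply: eq_bigr => s _.
by rewrite big_cons eq_sym subr_eq eq_sym addrC.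
Qed.

Section Commutation.
Context (A : V -> V) (b : int -> K).
Hypothesis lA : linear A.
Hypothesis BA : forall k v, B k (A v) = A (B k v) + b k *: v.

(** [B(z), A] is the scalar series b(z), hence [B(z)^n, A] = n b(z) B(z)^(n-1). *)
Lemma powser_comm d n k v : powser d n k (A v) = A (powser d n k v)
  + n%:R *: \sum_(j <- ints d) b j *: powser d n.-1 (k - j) v.
Proof.
elim: n k => [|n IH] k.
  by rewrite scale0r addr0 /=; case: ifP; rewrite // (lin0 lA).
rewrite [LHS]/=; under eq_bigr do rewrite IH (linD (lB _)) BA -addrA.
rewrite big_split/= (lin_sum lA); congr (_ + _).
rewrite big_split/= mulrS scalerDl scale1r; congr (_ + _).
under eq_bigr do rewrite (linZ (lB _)) (lin_sum (lB _)).
rewrite -scaler_sumr exchange_big/=.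
case: n {IH} => [|n]; first by rewrite !scale0r.
congr (_ *: _); apply: eq_bigr => j _; rewrite scaler_sumr; apply: eq_bigr => i _.
by rewrite (linZ (lB _)); congr (_ *: B i (powser _ _ _ _)); ring.
Qed.

(** Summing over n, [exp B(z), A] = b(z) exp B(z). Commutation with A acts like
    a derivation, so it lowers the order of the truncation by one. *)
Lemma texp_comm d N k v : texp d N.+1 k (A v) = A (texp d N.+1 k v)
  + \sum_(j <- ints d) b j *: texp d N (k - j) v.
Proof.
rewrite /texp; under eq_bigr do rewrite powser_comm scalerDr.
rewrite big_split/= (lin_sum lA); congr (_ + _).
  by apply: eq_bigr => n _; rewrite (linZ lA).
rewrite big_ord_recl scale0r scaler0 add0r.
under [RHS]eq_bigr do rewrite scaler_sumr.
rewrite exchange_big/=; apply: eq_bigr => n _.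
rewrite scalerA /bump/= add1n factS natrM invfM mulrAC mulVf ?pnatr_eq0// mul1r.
rewrite scaler_sumr; apply: eq_bigr => j _.
by rewrite !scalerA mulrC.
Qed.
End Commutation.

End TruncatedExp.

Section TexpNil.
Context (K : numFieldType) (V W : lmodType K) (B : int -> V -> V) (L : V -> W).
Hypotheses (lB : forall i, linear (B i)) (lL : linear L).

(** Used with L = id on the vacuum for annihilation operators, and with L the
    constant coefficient for creation operators. *)
Lemma texp_nil d N k v : (forall s, s != [::] -> L (foldr B v s) = 0) ->
  L (texp B d N.+1 k v) = if k == 0 then L v else 0.
Proof.
move=> L0; rewrite /texp (lin_sum lL) big_ord_recl big1 ?addr0 => [|n _].
  by rewrite (linZ lL) invr1 scale1r /=; case: ifP => //; rewrite (lin0 lL).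
rewrite (linZ lL) (powserE lB) (lin_sum lL) big1_seq ?scaler0// => s /andP[_].
by rewrite mem_words => /andP[/eqP sn _]; apply: L0; case: s sn.
Qed.

End TexpNil.

Definition small (d : nat) (s : seq int) : bool :=
  (size s <= d)%N && all (fun x : int => `|x| <= d)%N s.

Lemma small_le d d' s : (d <= d')%N -> small d s -> small d' s.
Proof.
move=> dd /andP[sd /allP ad]; rewrite /small (leq_trans sd dd).
by apply/allP => x /ad/leq_trans; apply.
Qed.

(** The sums over all integer words of a given total that define exponentials,
    once the support lies in a box, are graded by the length of the word. *)
Lemma fsum_words (V : zmodType) d N (k : int) (g : seq int -> V) : (d < N)%N ->
  (forall s, \sum_(i <- s) i = k -> g s != 0 -> small d s) ->
  (\sum_(s \in [set s : seq int | \sum_(i <- s) i = k]%classic) g s)%R =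
  \sum_(n < N) \sum_(s <- words d n | \sum_(i <- s) i == k) g s.
Proof.
move=> dN gd; pose r := flatten [seq words d n | n <- iota 0 N].
have mr s : (s \in r) = (size s < N)%N && all (fun x : int => `|x| <= d)%N s.
  apply/flatten_mapP/andP => [[n]|[sN sd]].
    by rewrite mem_iota mem_words => /= nN /andP[/eqP -> ->].
  by exists (size s); rewrite ?mem_iota// mem_words eqxx.
have ur : uniq r.
  rewrite /r {mr r gd dN}; elim: N => // N IH.
  rewrite -addn1 iotaD map_cat flatten_cat/= cats0 cat_uniq IH words_uniq andbT.
  apply/hasPn => s; rewrite mem_words => /andP[/eqP sN _].
  apply/flatten_mapP => -[n]; rewrite mem_iota mem_words sN => /andP[_ nN].
  by rewrite gtn_eqF.
rewrite (_ : [set s | _]%classic = [set` [pred s | \sum_(i <- s) i == k]]%classic).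
  rewrite -(bigfs _ ur) => [|s /= /eqP sk].
    rewrite big_mkcond big_flatten/= big_map -[N in iota _ N]subn0 big_mkord.
    by apply: eq_bigr => n _; rewrite [RHS]big_mkcond.
  rewrite mr => sr; apply/eqP; apply: contraNT sr.
  by move=> /(gd _ sk)/andP[sd ->]; rewrite andbT (leq_ltn_trans sd).
by apply/seteqP; split => s /= /eqP.
Qed.

Lemma texp_words (K : numFieldType) (V : lmodType K) (B : int -> V -> V) d N k v :
  (forall i, linear (B i)) -> texp B d N k v =
  \sum_(n < N) \sum_(s <- words d n | \sum_(i <- s) i == k)
     ((size s)`!)%:R^-1 *: foldr B v s.
Proof.
move=> lB; apply: eq_bigr => n _; rewrite powserE// scaler_sumr.
rewrite big_seq_cond [RHS]big_seq_cond; apply: eq_bigr => s /andP[].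
by rewrite mem_words => /andP[/eqP ->].
Qed.

(** * Exponentials on the Fock space and on its dual *)

Notation dualmod K := ((mono -> K^o) : lmodType K).

Section Bounded.
Context (K : numFieldType).

Definition bounded (B : int -> fock K -> fock K) k v d :=
  forall s, \sum_(i <- s) i = k -> foldr B v s != 0 -> small d s.

Lemma boundedW B k v d d' : (d <= d')%N -> bounded B k v d -> bounded B k v d'.
Proof. by move=> dd bd s sk /(bd _ sk); exact: small_le. Qed.

Lemma expserE B k v d N : (forall i, linear (B i)) -> bounded B k v d ->
  (d < N)%N -> expser (@fsum K) B k v = texp B d N k v.
Proof.
move=> lB bd dN; rewrite texp_words//; apply: (fsum_words dN) => s sk.
by rewrite scaler_eq0 negb_or => /andP[_ /(bd _ sk)].
Qed.

Lemma cexpserE (B : int -> dualmod K -> dualmod K) k u m d N :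
  (forall i, linear (B i)) ->
  (forall s, \sum_(i <- s) i = k -> foldr B u s m != 0 -> small d s) ->
  (d < N)%N -> expser (@cfsum K) B k u m = texp B d N k u m.
Proof.
move=> lB bd dN; have lm : linear (fun w : dualmod K => w m : K^o) by [].
rewrite texp_words// (lin_sum lm); under [RHS]eq_bigr do rewrite (lin_sum lm).
apply: (fsum_words dN) => s sk.
by rewrite -[_ m]/(_ * _) mulf_eq0 negb_or => /andP[_ /(bd _ sk)].
Qed.

Section Locfin.
Context (B : int -> fock K -> fock K).
Hypotheses (lB : forall i, linear (B i))
  (fB : forall k v, exists d, bounded B k v d).

Local Notation E := (expser (@fsum K) B).

Lemma expser_linear k : linear (E k).
Proof.
move=> a u v; have [[d1 b1] [d2 b2] [d3 b3]] :=
  And3 (fB k u) (fB k v) (fB k (a *: u + v)).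
pose d := maxn d1 (maxn d2 d3).
have le1 : (d1 <= d)%N by lia. have le2 : (d2 <= d)%N by lia.
have le3 : (d3 <= d)%N by lia.
rewrite (expserE lB (boundedW le1 b1) (ltnSn d)).
rewrite (expserE lB (boundedW le2 b2) (ltnSn d)).
rewrite (expserE lB (boundedW le3 b3) (ltnSn d)).
exact: texp_linear.
Qed.

Lemma expser_comm (A : fock K -> fock K) n p q :
  linear A ->
  (forall k v, B k (A v) = A (B k v) + (p *+ (k == n) + q *+ (k == - n)) *: v) ->
  forall k v, E k (A v) = A (E k v) + p *: E (k - n) v + q *: E (k + n) v.
Proof.
move=> lA BA k v.
have [[d1 b1] [d2 b2]] := conj (fB k (A v)) (fB k v).
have [[d3 b3] [d4 b4]] := conj (fB (k - n) v) (fB (k + n) v).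
pose d := (`|n| + (d1 + (d2 + (d3 + d4))))%N.
have le1 : (d1 <= d)%N by lia. have le2 : (d2 <= d)%N by lia.
have le3 : (d3 <= d)%N by lia. have le4 : (d4 <= d)%N by lia.
(* one order more on the left, as commutation loses one order *)
have dd : (d < d.+2)%N by [].
rewrite (expserE lB (boundedW le1 b1) dd) (expserE lB (boundedW le2 b2) dd).
rewrite (expserE lB (boundedW le3 b3) (ltnSn d)).
rewrite (expserE lB (boundedW le4 b4) (ltnSn d)).
rewrite (texp_comm lB lA BA) -addrA; congr (_ + _).
under eq_bigr do rewrite scalerDl.
rewrite big_split/=; congr (_ + _).
  rewrite (@sum_ints1 _ _ n) ?eqxx//; first by rewrite /d; lia.
  by move=> i /negbTE ->; rewrite mulr0n scale0r.
rewrite (@sum_ints1 _ _ (- n)) ?eqxx ?opprK//; first by rewrite /d; lia.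
by move=> i /negbTE ->; rewrite mulr0n scale0r.
Qed.

Lemma expser_nil (W : lmodType K) (L : fock K -> W) k v : linear L ->
  (forall s, s != [::] -> L (foldr B v s) = 0) ->
  L (E k v) = if k == 0 then L v else 0.
Proof.
move=> lL L0; have [d bd] := fB k v.
by rewrite (expserE lB bd (ltnSn d)) texp_nil.
Qed.

End Locfin.

(** The weight counts a_{-k} with degree k. *)
Definition wt (m : mono) : nat := (\sum_(k <- finsupp m) k.+1 * m k)%N.

Lemma wt_mulU m k : wt (mmul m (ucm k)) = (wt m + k.+1)%N.
Proof.
have wtw (m' : mono) (d : {fset nat}) : (finsupp m' `<=` d)%fset ->
    wt m' = (\sum_(k <- d) k.+1 * m' k)%N.
  move=> md; rewrite /wt (big_fset_incl _ md)// => x _.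
  by rewrite -cmE_eq0 => /eqP ->; rewrite muln0.
set d := finsupp (mmul m (ucm k)).
have kd : k \in d by rewrite /d mdomD mdomU !inE eqxx orbT.
rewrite (wtw m d) /d ?mdomD ?fsubsetUl// -mdomD -/d /wt.
under eq_bigr do rewrite cmM mulnDr.
rewrite big_split/=; congr addn.
rewrite (bigD1_seq k) ?fset_uniq//= cmUU muln1 big1 ?addn0// => j jk.
by rewrite cmU eq_sym (negbTE jk) muln0.
Qed.

(** M is generated from the vacuum by the creation operators. *)
Lemma mono_ind (P : mono -> Prop) : P mone ->
  (forall m k, P m -> P (mmul m (ucm k))) -> forall m, P m.
Proof.
move=> P1 PM m; have [n] := ubnP (wt m); elim: n m => // n IH m mn.
have [->|m1] := eqVneq m mone => //.
have [k mk] : exists k, m k != 0%N.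
  apply: contrapT => nk; move/negP: m1; apply; apply/cmP => k.
  by rewrite cm1; apply: contrapT => mk; apply: nk; exists k; apply/eqP.
rewrite -(mulDU mk); apply/PM/IH; move: mn; rewrite -{1}(mulDU mk) wt_mulU.
by lia.
Qed.

Lemma ract_linear n : linear (ract n : dualmod K -> dualmod K).
Proof.
move=> a u v; apply/funext => m; rewrite -[RHS]/(a * _ m + _ m).
case: n => [[|k]|k] /=; rewrite -?[(a *: u + v) _]/(a * u _ + v _).
- by rewrite mulr0 addr0.
- by case: ifP => _; rewrite ?mulr0 ?addr0.
- by ring.
Qed.

Lemma act_linear n : linear (act n : fock K -> fock K).
Proof.
move=> a u v; apply/malgP => m; rewrite mcoeffD mcoeffZ.
pose c w : dualmod K := fun m => w@_m.
have actE w : (act n w)@_m = ract (- n) (c w) m by exact: act_coef.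
apply: (etrans (actE _)); apply: esym.
apply: (etrans (congr2 (fun x y => a * x + y) (actE u) (actE v))).
transitivity ((a *: ract (- n) (c u) + ract (- n) (c v)) m) => //.
rewrite -ract_linear; congr (ract _ _ m); apply/funext => m'.
by rewrite /c mcoeffD mcoeffZ.
Qed.

End Bounded.

(** * Creation and annihilation series *)

(** The common form of the annihilation exponents: P = (k < 0) for X and
    P = (k <> 0) for Y and W, whose exponents are symmetric under z -> 1/z. *)
Definition annser (K : numFieldType) (V : lmodType K) (a : int -> V -> V)
    (P : pred int) (c : K) : opser V :=
  fun k v => if P k then (c / `|k|%:~R) *: a `|k| v else 0.

Lemma anexpE (K : numFieldType) (V : lmodType K) (a : int -> V -> V) c :
  anexp a c = annser a (fun k => k < 0) c.
Proof.
apply/funext => k; apply/funext => v; rewrite /anexp /annser.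
by case: ifP => // k0; rewrite ltr0_norm.
Qed.

Section LinearSeries.
Context (K : numFieldType) (V : lmodType K) (a : int -> V -> V).
Hypothesis la : forall n, linear (a n).

Lemma crexp_linear c k : linear (crexp a c k).
Proof.
move=> x u v; rewrite /crexp; case: ifP => _; last by rewrite scaler0 addr0.
by rewrite la scalerDr !scalerA mulrC.
Qed.

Lemma annser_linear P c k : linear (annser a P c k).
Proof.
move=> x u v; rewrite /annser; case: ifP => _; last by rewrite scaler0 addr0.
by rewrite la scalerDr !scalerA mulrC.
Qed.
End LinearSeries.

Lemma foldr_all (K : numFieldType) (V : lmodType K) (B : int -> V -> V)
    (Q : pred int) v s :
  (forall k u, ~~ Q k -> B k u = 0) -> (forall k, linear (B k)) ->
  foldr B v s != 0 -> all Q s.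
Proof.
move=> BQ lB; elim: s => //= k s IH kn; rewrite IH ?andbT.
  by apply: contraNT kn => /BQ ->.
by apply: contraNneq kn => ->; rewrite (lin0 (lB k)).
Qed.

Definition normsum (s : seq int) : nat := \sum_(x <- s) absz x.

Lemma small_normsum s : all (fun x : int => x != 0) s -> small (normsum s) s.
Proof.
rewrite /normsum /small; elim: s => [|x s IH]; first by rewrite big_nil.
rewrite big_cons /= => /andP[x0 /IH /andP[ss /allP sa]].
apply/and3P; split; [lia|lia|apply/allP => y /sa]; lia.
Qed.

(** In positive words, the total already bounds length and letters. *)
Lemma normsum_pos s : all (fun x : int => 0 < x) s ->
  (normsum s)%:Z = \sum_(x <- s) x.
Proof.
rewrite /normsum; elim: s => [|x s IH]; first by rewrite !big_nil.
by rewrite !big_cons /= => /andP[x0 /IH <-]; lia.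
Qed.

Lemma crexp_small (K : numFieldType) (V : lmodType K) (a : int -> V -> V)
    c (v : V) k s : (forall n, linear (a n)) ->
  \sum_(x <- s) x = k -> foldr (crexp a c) v s != 0 -> small `|k| s.
Proof.
move=> la sk f0; have s0 : all (fun x : int => 0 < x) s.
  apply: foldr_all f0; last exact: crexp_linear.
  by move=> j u; rewrite /crexp => /negbTE ->.
rewrite -sk -normsum_pos//; apply: small_normsum.
by apply: sub_all s0 => x; lia.
Qed.

Section Commutators.
Context (K : numFieldType) (V : lmodType K) (a : int -> V -> V).
Hypotheses (la : forall n, linear (a n))
  (ac : forall i j v, i != 0 -> j != 0 ->
     a i (a j v) - a j (a i v) = (i *+ (i + j == 0))%:~R *: v).
Variables (P : pred int) (P0 : ~~ P 0).

(** [a_|k|, a_n] is nonzero only when n = -|k|, that is for k = n or k = -n with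
    n < 0; the factor |k| cancels the denominator of the exponent. *)
Lemma annser_comm c n k v : n != 0 ->
  annser a P c k (a n v) = a n (annser a P c k v)
  + ((if (n < 0) && P n then c else 0) *+ (k == n)
     + (if (n < 0) && P (- n) then c else 0) *+ (k == - n)) *: v.
Proof.
move=> n0; rewrite /annser; have [Pk|Pk] := boolP (P k); last first.
  rewrite (lin0 (la n)) add0r; case: (k =P n) => [kn|_].
    rewrite -kn (negbTE Pk) andbF mul0rn add0r.
    by rewrite (_ : (k == - k) = false) ?mulr0n ?scale0r//; lia.
  rewrite mulr0n add0r; case: eqP => [<-|_]; last by rewrite mulr0n scale0r.
  by rewrite (negbTE Pk) andbF mul0rn scale0r.
have k0 : k != 0 by apply: contraTneq Pk => ->.
have k0' : `|k| != 0 by rewrite normr_eq0.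
have /eqP := @ac `|k| n v k0' n0; rewrite subr_eq addrC => /eqP ->.
rewrite scalerDr (linZ (la n)) scalerA; congr (_ + _ *: _).
have kK : (`|k|%:~R : K) != 0 by rewrite intr_eq0.
have [kn|kn] := eqVneq k n.
  rewrite -kn; have [k1|k1] := ltrP k 0.
    rewrite (_ : (k == - k) = false) ?mulr0n ?addr0; last by lia.
    by rewrite {3}ltr0_norm// addNr eqxx Pk mulr1n divfK.
  rewrite ger0_norm// (_ : (k + k == 0) = false) ?mulr0n ?mulr0 ?mul0rn ?addr0//.
  lia.
rewrite mulr0n add0r; have [kn'|kn'] := eqVneq k (- n).
  rewrite -kn' Pk andbT mulr1n; case: ltrP => n1.
    have nk : n = - `|k| by lia.
    by rewrite [in X in X == 0]nk addrN eqxx mulr1n divfK.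
  by rewrite (_ : (_ == 0) = false) ?mulr0//; lia.
by rewrite (_ : (_ == 0) = false) ?mulr0//; lia.
Qed.

Lemma crexp_comm c n k v : n != 0 ->
  crexp a c k (a n v) = a n (crexp a c k v)
  + ((if 0 < n then - c else 0) *+ (k == n) + 0 *+ (k == - n)) *: v.
Proof.
move=> n0; rewrite mul0rn addr0 /crexp; have [k0|k0] := boolP (0 < k); last first.
  rewrite (lin0 (la n)) add0r.
  case: (k =P n) => [<-|_]; last by rewrite scale0r.
  by rewrite (negbTE k0) mul0rn scale0r.
have k0' : - k != 0 by rewrite oppr_eq0 gt_eqF.
have /eqP := @ac (- k) n v k0' n0; rewrite subr_eq addrC => /eqP ->.
rewrite scalerDr (linZ (la n)) scalerA; congr (_ + _ *: _).
have kK : (k%:~R : K) != 0 by rewrite intr_eq0 gt_eqF.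
rewrite addrC subr_eq0 eq_sym; case: eqP => [<-|_]; last by rewrite mulr0.
by rewrite k0 !mulr1n rmorphN mulrN divfK.
Qed.

End Commutators.

Section Series.
Context (K : numFieldType).
Local Opaque act ract.

(** The weight filtration, indexed by int so that a_n lowers it by n whatever
    the sign of n, and the step of negative index is 0. *)
Definition wtle (d : int) (v : fock K) := forall m, v@_m != 0 -> (wt m)%:Z <= d.

Lemma wtle_act n d v : wtle d v -> wtle (d - n) (act n v).
Proof.
move=> dv m; case: n => [[|k]|k].
- by rewrite mcoeff0 eqxx.
- by rewrite act_posE mulf_eq0 negb_or => /andP[_ /dv]; rewrite wt_mulU; lia.
- rewrite act_negE; case: ifP => [_|/negbT mk]; first by rewrite eqxx.
  move/dv; rewrite -[in X in _ -> X](mulDU mk) wt_mulU; lia.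
Qed.

Lemma wtle_ex v : exists d : nat, wtle d v.
Proof.
exists (\max_(m <- msupp v) wt m)%N => m; rewrite mcoeff_neq0 => mv.
by rewrite lez_nat; apply: leq_bigmax_seq.
Qed.

Lemma wtle_neg d v : d < 0 -> wtle d v -> v = 0.
Proof.
move=> d0 dv; apply/malgP => m; rewrite mcoeff0; apply/eqP.
by apply: contraTT d0 => /dv; lia.
Qed.

Lemma wtle_foldr P c d v s :
  wtle d v -> wtle (d - (normsum s)%:Z) (foldr (annser (@act K) P c) v s).
Proof.
rewrite /normsum => dv; elim: s => [|x s IH] /=; first by rewrite big_nil subr0.
rewrite big_cons {1}/annser => m; case: ifP => _; last by rewrite mcoeff0 eqxx.
rewrite mcoeffZ mulf_eq0 negb_or => /andP[_ /(wtle_act IH)]; lia.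
Qed.

Section Annihilation.
Variables (P : pred int) (P0 : ~~ P 0).

Lemma annser_nz (V : lmodType K) (a : int -> V -> V) c (v : V) s :
  (forall n, linear (a n)) ->
  foldr (annser a P c) v s != 0 -> all (fun x : int => x != 0) s.
Proof.
move=> la f0; apply: foldr_all f0; last exact: annser_linear.
by move=> j u; rewrite negbK /annser => /eqP ->; rewrite (negbTE P0).
Qed.

(** Annihilation operators of total weight above d kill filtration step d. *)
Lemma annser_normsum c v (d : nat) s : wtle d v ->
  foldr (annser (@act K) P c) v s != 0 -> (normsum s <= d)%N.
Proof.
move=> dv; apply: contraR => ds; apply/eqP.
by apply: (wtle_neg _ (wtle_foldr dv)); lia.
Qed.

Lemma annser_bounded c k v (d : nat) : wtle d v ->
  bounded (annser (@act K) P c) k v d.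
Proof.
move=> dv s _ f0; apply: small_le (annser_normsum dv f0) _.
exact: small_normsum (annser_nz (@act_linear K) f0).
Qed.

End Annihilation.
End Series.

(** * Vertex operators and their commutators with the Heisenberg algebra *)

Lemma sum_lin5 (K : numFieldType) (V : lmodType K) I (r : seq I)
    (f g1 g2 g3 g4 : I -> V) a1 a2 a3 a4 :
  \sum_(i <- r) (f i + a1 *: g1 i + a2 *: g2 i + a3 *: g3 i + a4 *: g4 i) =
  \sum_(i <- r) f i + a1 *: (\sum_(i <- r) g1 i) + a2 *: (\sum_(i <- r) g2 i)
  + a3 *: (\sum_(i <- r) g3 i) + a4 *: (\sum_(i <- r) g4 i).
Proof. by rewrite !scaler_sumr !big_split. Qed.

Lemma merge5 (K : numFieldType) (V : lmodType K) (x y z : V) a1 a2 a3 a4 :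
  x + a1 *: y + a2 *: z + a3 *: y + a4 *: z =
  x + (a1 + a3) *: y + (a2 + a4) *: z.
Proof. by rewrite !scalerDl -!addrA; congr (_ + (_ + _)); rewrite addrCA. Qed.

(** For T(z) = sum_k T_k z^k: T(z) A = (A + p z^n + q z^{-n}) T(z). *)
Definition comrel (K : numFieldType) (V : lmodType K) (A : V -> V)
    (T : opser V) (n : int) (p q : K) := forall k v,
  T k (A v) = A (T k v) + p *: T (k - n) v + q *: T (k + n) v.

(** raise c and lower P c are the exponentials of c times the creation,
    respectively annihilation, sums; vtx P 1 is X or Y, and vtx P (-1) is X^* or
    W^*, acting on the left; W and Y^* are the multiples of Y and W^* by
    1 - z^2. *)
HB.lock Definition raise (K : numFieldType) (c : K) : opser (fock K) :=
  expser (@fsum K) (crexp (@act K) c).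
HB.lock Definition lower (K : numFieldType) (P : pred int) (c : K) :
  opser (fock K) := expser (@fsum K) (annser (@act K) P c).
HB.lock Definition vtx (K : numFieldType) (P : pred int) (c : K) :
  opser (fock K) := mulser (@fsum K) (raise c) (lower P (- c)).
Arguments raise {K} c k v.
Arguments lower {K} P c k v.
Arguments vtx {K} P c k v.

Section Vertex.
Context (K : numFieldType).
Implicit Types (c : K) (v : fock K) (k : int).

Lemma crexp_bounded c k v : bounded (crexp (@act K) c) k v `|k|.
Proof. move=> s; exact: crexp_small (@act_linear K). Qed.

Lemma crexp_locfin c k v : exists d, bounded (crexp (@act K) c) k v d.
Proof. by exists `|k|%N; exact: crexp_bounded. Qed.

Let lcr c k : linear (crexp (@act K) c k).
Proof. exact: (crexp_linear (@act_linear K)). Qed.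

Lemma raise_linear c k : linear (raise c k).
Proof. rewrite raise.unlock; exact: (expser_linear (lcr c) (@crexp_locfin c)). Qed.

Lemma raise_comm c n : n != 0 ->
  comrel (act n) (raise c) n (if 0 < n then - c else 0) 0.
Proof.
move=> n0; rewrite raise.unlock.
apply: (expser_comm (lcr c) (@crexp_locfin c) (@act_linear K n)).
by move=> k v; exact: (crexp_comm (@act_linear K) (@act_comm K)).
Qed.

Lemma raise_neg c k v : k < 0 -> raise c k v = 0.
Proof.
move=> k0; rewrite raise.unlock (expserE (lcr c) (@crexp_bounded c k v) (ltnSn _)).
rewrite texp_words//; apply: big1 => n _; apply: big1 => s /eqP sk.
apply/eqP; rewrite scaler_eq0; apply/orP; right; apply: contraTT k0 => f0.
rewrite -leNgt -sk -normsum_pos//; apply: foldr_all f0; last exact: lcr.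
by move=> j u; rewrite /crexp => /negbTE ->.
Qed.

Lemma act_coef1 n v : n < 0 -> (act n v)@_mone = 0 :> K.
Proof. by case: n => // k _; rewrite act_negE cm1. Qed.

(** Nonempty products of creation operators have no constant term. *)
Lemma raise_coef1 c k (v : fock K) :
  (raise c k v)@_mone = if k == 0 then v@_mone else 0.
Proof.
have l1 : linear (fun w : fock K => w@_mone : K^o).
  by move=> x u w; rewrite mcoeffD mcoeffZ.
rewrite raise.unlock.
have /(_ k v) := @expser_nil _ _ (lcr c) (@crexp_locfin c) _ _ _ _ l1.
apply => -[|x s]//= _.
rewrite {1}/crexp; case: ifP => x0; last by rewrite mcoeff0.
by rewrite mcoeffZ act_coef1 ?mulr0// oppr_lt0.
Qed.

Section Lower.
Variables (P : pred int) (P0 : ~~ P 0).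

Let lan c k : linear (annser (@act K) P c k).
Proof. exact: (annser_linear (@act_linear K)). Qed.

Let fan c k v : exists d, bounded (annser (@act K) P c) k v d.
Proof. by have [d dv] := wtle_ex v; exists d; exact: annser_bounded. Qed.

Lemma lower_linear c k : linear (lower P c k).
Proof. rewrite lower.unlock; exact: (expser_linear (lan c) (fan c)). Qed.

Lemma lower_comm c n : n != 0 -> comrel (act n) (lower P c) n
  (if (n < 0) && P n then c else 0) (if (n < 0) && P (- n) then c else 0).
Proof.
move=> n0; rewrite lower.unlock.
apply: (expser_comm (lan c) (fan c) (@act_linear K n)).
by move=> k v; exact: (annser_comm (@act_linear K) (@act_comm K) P0).
Qed.

Lemma lower_vac c k : lower P c k (vac K) = if k == 0 then vac K else 0.
Proof.
rewrite lower.unlock; apply: (@expser_nil _ _ (lan c) (fan c) _ id) => // s.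
elim: s => //= x [|y s] IH _; last by rewrite IH// (lin0 (lan c x)).
rewrite /= /annser; case: ifP => // Px; rewrite act_vac ?scaler0//.
by rewrite normr_gt0; apply: contraTneq Px => ->.
Qed.

Lemma normsum_ge s : `|\sum_(x <- s) x| <= (normsum s)%:Z.
Proof.
rewrite /normsum; elim: s => [|x s IH]; first by rewrite !big_nil.
by rewrite !big_cons PoszD (le_trans (ler_normD _ _))// lerD// abszE.
Qed.

Lemma lower_big c k v (d : nat) : wtle d v -> (d < `|k|)%N -> lower P c k v = 0.
Proof.
move=> dv dk.
rewrite lower.unlock.
rewrite (expserE (lan c) (annser_bounded P0 (c := c) (k := k) dv) (ltnSn _)).
rewrite texp_words//; apply: big1 => n _; apply: big1 => s /eqP sk.
apply/eqP; rewrite scaler_eq0; apply/orP; right; apply: contraTT dk => f0.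
have := annser_normsum P0 dv f0; have := normsum_ge s; rewrite sk; lia.
Qed.

Variable c : K.
Local Notation T := (vtx P c).
Let summand k v (i : int) : fock K := raise c i (lower P (- c) (k - i) v).

Lemma summand_supp (d : nat) k v i : wtle d v -> summand k v i != 0 ->
  (`|i| <= d + `|k|)%N.
Proof.
move=> dv; apply: contraR => di; apply/eqP; rewrite /summand.
by rewrite (lower_big _ dv) ?(lin0 (raise_linear c i))//; lia.
Qed.

Lemma vtxE (d D : nat) k v : wtle d v -> (d + `|k| <= D)%N ->
  T k v = \sum_(i <- ints D) raise c i (lower P (- c) (k - i) v).
Proof.
move=> dv dD; rewrite vtx.unlock; apply: (sum_ints_fs (f := summand k v)) => i.
by move/(summand_supp dv); lia.
Qed.

Lemma wtleW (d d' : nat) (v : fock K) : (d <= d')%N -> wtle d v -> wtle d' v.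
Proof. by move=> dd dv m /dv; lia. Qed.

Lemma vtx_linear k : linear (T k).
Proof.
move=> a u v; have [d1 du] := wtle_ex u; have [d2 dv] := wtle_ex v.
have [d3 dw] := wtle_ex (a *: u + v).
rewrite !(@vtxE (d1 + d2 + d3) (d1 + d2 + d3 + `|k|)) ?leqnn//; last first.
- by apply: wtleW dw; lia.
- by apply: wtleW du; lia.
- by apply: wtleW dv; lia.
rewrite scaler_sumr -big_split/=; apply: eq_bigr => i _.
by rewrite lower_linear raise_linear.
Qed.

(** The shifts of the two factors add up: a shift in the exponent of either
    factor becomes, after reindexing, a shift in the exponent of the product. *)
Lemma vtx_comrel A n p q p' q' : linear A ->
  comrel A (raise c) n p q -> comrel A (lower P (- c)) n p' q' ->
  comrel A T n (p + p') (q + q').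
Proof.
move=> lA rA sA k v; have [d1 d1v] := wtle_ex v; have [d2 d2v] := wtle_ex (A v).
pose d := (d1 + d2)%N.
have dv : wtle d v by apply: wtleW d1v; lia.
have dav : wtle d (A v) by apply: wtleW d2v; lia.
pose D0 := (d + `|k| + `|n|)%N; pose D := (D0 + `|n|)%N.
rewrite (vtxE (D := D) dav) ?(vtxE (D := D) (k := k) dv)//;
  try by rewrite /D /D0; lia.
have shift j : `|j|%N = `|n|%N :> nat ->
    \sum_(i <- ints D) raise c (i - j) (lower P (- c) (k - i) v) = T (k - j) v.
  move=> jn; rewrite (vtxE (D := D0) dv); last by rewrite /D0; lia.
  rewrite -(@sum_ints_shift _ D0 j (summand (k - j) v)).
    rewrite /D -jn; apply: eq_bigr => i _; rewrite /summand.
    by rewrite (_ : k - j - (i - j) = k - i)//; ring.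
  by move=> i /(summand_supp dv); rewrite /D0; lia.
have swap j : `|j|%N = `|n|%N :> nat ->
    \sum_(i <- ints D) raise c i (lower P (- c) (k - i - j) v) = T (k - j) v.
  move=> jn; rewrite (vtxE (D := D) dv); last by rewrite /D /D0; lia.
  apply: eq_bigr => i _.
  by rewrite (_ : k - j - i = k - i - j)//; ring.
have nn : `|- n|%N = `|n|%N :> nat by lia.
have e1 := shift n erefl; have e2 := swap n erefl.
have e3 := shift (- n) nn; have e4 := swap (- n) nn; rewrite !opprK in e3 e4.
have summandE (i : int) : raise c i (lower P (- c) (k - i) (A v)) =
    A (raise c i (lower P (- c) (k - i) v))
    + p *: raise c (i - n) (lower P (- c) (k - i) v)
    + q *: raise c (i + n) (lower P (- c) (k - i) v)
    + p' *: raise c i (lower P (- c) (k - i - n) v)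
    + q' *: raise c i (lower P (- c) (k - i + n) v).
  rewrite (sA (k - i) v); move: (lower _ _ (k - i) v) (lower _ _ (k - i - n) v).
  move: (lower _ _ (k - i + n) v) => w3 w1 w2.
  by rewrite (lin3 (raise_linear c i)) rA.
apply: (etrans (eq_bigr _ (fun i _ => summandE i))).
apply: (etrans (sum_lin5 _ _ _ _ _ _ _ _ _ _)).
rewrite e1 e2 e3 e4 -(lin_sum lA).
exact: merge5.
Qed.
End Lower.
End Vertex.

(** * Operator families determined by their vacuum expectation values *)

Section Bicomrel.
Context (K : numFieldType) (V : lmodType K) (A : V -> V) (lA : linear A).
Variables (n : int) (p q : K).

(** For F(z,w) = sum_{a,b} F_{a,b} z^a w^b:
    F(z,w) A = (A + p z^n + q z^{-n} - p w^n - q w^{-n}) F(z,w). *)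
Definition birel (F : int -> int -> V -> V) := forall a b v,
  F a b (A v) = A (F a b v) + p *: F (a - n) b v + q *: F (a + n) b v
    + (- p) *: F a (b - n) v + (- q) *: F a (b + n) v.

Lemma birelD F G : birel F -> birel G -> birel (fun a b v => F a b v + G a b v).
Proof.
move=> bF bG a b v; rewrite bF bG (linD lA) !scalerDr.
by do 4!(rewrite [LHS]addrACA; congr (_ + _)).
Qed.

Lemma birelN F : birel F -> birel (fun a b v => - F a b v).
Proof. by move=> bF a b v; rewrite bF (linN lA) !opprD !scalerN. Qed.

(** Because (z^n - w^n) delta(z/w) = 0 for delta(z/w) = sum_a (z/w)^a. *)
Lemma birel_delta : birel (fun a b v => (a + b == 0)%:R *: v).
Proof.
move=> a b v; rewrite (linZ lA) (_ : a - n + b = a + (b - n)); last by ring.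
rewrite (_ : a + n + b = a + (b + n)); last by ring.
rewrite !scaleNr; move: (_ *: A v) (p *: _) (q *: _) => x y z.
by rewrite (addrAC (x + y)) !addrK.
Qed.

Lemma birel_mul T T' : (forall k, linear (T' k)) ->
  comrel A T n p q -> comrel A T' n (- p) (- q) ->
  birel (fun a b v => T' b (T a v)).
Proof.
move=> lT' cT cT' a b v; rewrite cT (lin3 (lT' b)) cT'.
by rewrite -!addrA; congr (_ + _); rewrite addrA [RHS]addrA addrC.
Qed.

(** Multiplying T(z) T'(w) by w/z commutes with everything. *)
Lemma birel_mulC T T' : (forall k, linear (T k)) ->
  comrel A T n p q -> comrel A T' n (- p) (- q) ->
  birel (fun a b v => T (a + 1) (T' (b - 1) v)).
Proof.
move=> lT cT cT' a b v; rewrite cT' (lin3 (lT _)) cT.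
by rewrite !(addrAC _ 1) !(addrAC _ (- 1)).
Qed.

Lemma comrel_mul1z2 T : comrel A T n p q -> comrel A (mul1z2 T) n p q.
Proof.
move=> cT k v; rewrite /mul1z2 !cT (linB lA) !scalerBr.
rewrite !(addrAC k (- 2)) !opprD.
by do 2!(rewrite [LHS]addrACA; congr (_ + _)).
Qed.

End Bicomrel.

Section CoefficientInduction.
Context (K : numFieldType).
Implicit Types (v : fock K) (m : mono).

(** Up to a nonzero factor, a_{j+1} moves the coefficient at m a_{-(j+1)} to
    the coefficient at m. *)
Lemma coef_step m j v : (act j.+1%:Z v)@_m = 0 -> v@_(mmul m (ucm j)) = 0.
Proof. by move/eqP; rewrite act_posE mulf_eq0 pnatr_eq0 => /eqP. Qed.

Lemma coef_linear m : linear (fun v : fock K => v@_m : K^o).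
Proof. by move=> a u v; rewrite mcoeffD mcoeffZ. Qed.

Lemma act_mono j m : act (Negz j) << m >> = << mmul m (ucm j) >> :> fock K.
Proof. by rewrite /act malgM_def fgmulUU mulr1 mulmC. Qed.

Lemma fock_ind (I : Type) (F : I -> fock K -> fock K) :
  (forall i, linear (F i)) -> (forall i, F i (vac K) = 0) ->
  (forall j v, (forall i, F i v = 0) -> forall i, F i (act (Negz j) v) = 0) ->
  forall i v, F i v = 0.
Proof.
move=> lF F0 FS i v; have Fm m : forall i, F i << m >> = 0.
  elim/mono_ind: m => [//|m j IH] i'; rewrite -act_mono; exact: FS.
have vE : v = \sum_(m <- msupp v) v@_m *: << m >>.
  rewrite {1}[v]monalgE; apply: eq_bigr => m _; apply/malgP => m'.
  move: (v@_m) => x; rewrite (mcoeffU m x m') (mcoeffZ x << m >> m').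
  by rewrite (mcoeffU m 1 m') mulr_natr.
apply: (etrans (congr1 (F i) vE)); apply: (etrans (lin_sum (lF i) _ _ _)).
by apply: big1 => m _; rewrite (linZ (lF i) (v@_m)) Fm scaler0.
Qed.

Variables (F : int -> int -> fock K -> fock K) (p q : int -> K).
Hypotheses (lF : forall a b, linear (F a b))
  (bF : forall n, n != 0 -> birel (act n) n (p n) (q n) F).

(** First F_{a,b}|0> = 0, by induction on the monomial of which the coefficient
    is taken: applying a_n, n > 0, to F_{a,b}|0> gives a combination of other
    F_{a',b'}|0>. Then F_{a,b} v = 0 by induction on v, as commuting F_{a,b} with
    a_{-n} also gives combinations of F_{a',b'}. *)
Lemma birel_eq0 : (forall a b, (F a b (vac K))@_mone = 0) ->
  forall a b v, F a b v = 0.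
Proof.
move=> F1; have Fvac a b : F a b (vac K) = 0.
  apply/malgP => m; rewrite mcoeff0; elim/mono_ind: m a b => [//|m j IH] a b.
  apply: coef_step; pose n : int := j.+1.
  have n0 : n != 0 by [].
  have := bF n0 a b (vac K); rewrite (@act_vac K n)// (lin0 (lF a b)) => e.
  have := lin5 (coef_linear m) (act n (F a b (vac K))) (p n) (F (a - n) b (vac K))
    (q n) (F (a + n) b (vac K)) (- p n) (F a (b - n) (vac K))
    (- q n) (F a (b + n) (vac K)).
  by rewrite -e /= !IH mcoeff0 !scaler0 !addr0 => <-.
pose G (i : int * int) := F i.1 i.2.
have G0 := @fock_ind _ G (fun i => lF i.1 i.2) (fun i => Fvac i.1 i.2).
move=> a b v; apply: (G0 _ (a, b)) => j {}v IH [{}a {}b].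
have IH' a' b' : F a' b' v = 0 by exact: IH (a', b').
have n0 : Negz j != 0 by [].
apply: (etrans (bF n0 a b v)).
by rewrite !IH' !scaler0 !addr0 (lin0 (act_linear _)).
Qed.

End CoefficientInduction.

(** * Vacuum expectation values *)

Section NewtonAbstract.
Context (K : numFieldType) (V : lmodType K) (a : int -> V -> V).
Hypotheses (la : forall n, linear (a n))
  (ac : forall i j v, i != 0 -> j != 0 ->
     a i (a j v) - a j (a i v) = (i *+ (i + j == 0))%:~R *: v).
Variables (c : K) (h : int -> V).
Hypotheses (ah : forall n k, 0 < n -> a n (h k) = c *: h (k - n))
  (h_neg : forall k, k < 0 -> h k = 0).

(** The Newton identity k h_k = c sum_n a_{-n} h_{k-n} says that this vanishes
    for k <= N. *)
Definition newton_defect (N : nat) (k : int) : V :=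
  k%:~R *: h k - c *: \sum_(i < N) a (Negz i) (h (k - i.+1%:Z)).

(** The annihilation operators send defects to defects, because
    a_n h_k = c h_{k-n}: among the commutators [a_n, a_{-i}] only i = n
    contributes, and it accounts for k - n in place of k. *)
Lemma act_newton_defect N (j : nat) k : k <= N%:Z ->
  a j.+1 (newton_defect N k) = c *: newton_defect N (k - j.+1%:Z).
Proof.
move=> kN; rewrite /newton_defect (linB (la _)) !(linZ (la _)) (lin_sum (la _)).
set n : int := j.+1; have n0 : 0 < n by [].
have step (i : nat) : a n (a (Negz i) (h (k - i.+1%:Z))) =
    c *: a (Negz i) (h (k - n - i.+1%:Z))
    + (if i == j then n%:~R *: h (k - n) else 0).
  have /eqP := @ac n (Negz i) (h (k - i.+1%:Z)) isT isT.
  rewrite subr_eq [_ *: _ + _]addrC => /eqP ->; rewrite (ah _ n0) (linZ (la _)).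
  rewrite (addrAC k) NegzE subr_eq0 eqz_nat eqSS eq_sym; congr (_ + _).
  by case: eqP => [->|]; rewrite ?mulr1n ?mulr0n ?scale0r.
have delta : \sum_(i < N) (if i == j :> nat then n%:~R *: h (k - n) else 0)
    = n%:~R *: h (k - n).
  rewrite -big_mkcond; have [jN|Nj] := ltnP j N.
    by rewrite (big_pred1 (Ordinal jN)) // => i.
  by rewrite h_neg ?scaler0 ?big1//; lia.
under eq_bigr do rewrite step.
rewrite big_split/= delta -scaler_sumr (ah k n0).
move: (\sum_(i < N) _) (h (k - n)) => S H.
rewrite rmorphB scalerBl !(scalerBr, scalerDr) !scalerA opprD addrA (mulrC _ c).
by rewrite -!addrA; congr (_ + _); rewrite addrC.
Qed.
End NewtonAbstract.

Section VacuumExpectation.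
Context (K : numFieldType).
Implicit Types (c : K) (v : fock K) (k : int).

Lemma act_vac_raise c n k : 0 < n ->
  act n (raise c k (vac K)) = c *: raise c (k - n) (vac K).
Proof.
move=> n0; have nn : n != 0 by rewrite gt_eqF.
have := raise_comm c nn k (vac K); rewrite n0 (act_vac K n0).
rewrite (lin0 (raise_linear c k)) scale0r addr0 scaleNr => /esym/eqP.
by rewrite subr_eq0 => /eqP.
Qed.

(** The difference has no constant term and is annihilated by every a_n, n > 0,
    since raise c has no coefficient of negative index. *)
Lemma raise0_vac c : raise c 0 (vac K) = vac K.
Proof.
apply/eqP; rewrite -subr_eq0; apply/eqP; apply/malgP => m; rewrite mcoeff0.
elim/mono_ind: m => [|m j _].
  have := linB (coef_linear (mone : mono)) (raise c 0 (vac K)) (vac K).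
  by move=> /= ->; rewrite raise_coef1 eqxx subrr.
have jp : 0 < j.+1%:Z by [].
apply: coef_step; rewrite (linB (act_linear _)) (act_vac_raise c 0 jp) (act_vac K jp).
by rewrite raise_neg// scaler0 subr0 mcoeff0.
Qed.

Local Notation newt c := (newton_defect (@act K) c (fun k => raise c k (vac K))).

(** The annihilation operators permute the defects up to a scalar, and no
    defect has a constant term. *)
Lemma newton_defect_eq0 c N k : k <= N%:Z -> newt c N k = 0.
Proof.
move=> kN; apply/malgP => m; rewrite mcoeff0.
elim/mono_ind: m k kN => [|m j IH] k kN.
  rewrite /newton_defect; set S := \sum_(i < N) _.
  have S0 : S@_mone = 0.
    apply: (etrans (lin_sum (coef_linear (mone : mono)) _ _ _)).
    by apply: big1 => i _; exact: act_coef1.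
  clearbody S; have l1 := @coef_linear K (mone : mono).
  apply: (etrans (linB l1 _ _)).
  apply: (etrans (congr2 (fun x y : K => x - y) (linZ l1 _ _) (linZ l1 _ _))).
  rewrite /= S0 raise_coef1 scaler0 subr0.
  by case: eqP => [->|]; rewrite ?scale0r ?scaler0.
apply: coef_step.
rewrite (act_newton_defect (@act_linear K) (@act_comm K) _ _ _ kN).
- by rewrite (mcoeffZ c (newt c N (k - j.+1%:Z))) IH ?mulr0//; lia.
- by move=> n i; exact: act_vac_raise.
- by move=> i i0; exact: raise_neg.
Qed.

Lemma newton c (N : nat) : N%:R *: raise c N (vac K) =
  c *: \sum_(i < N) act (Negz i) (raise c (N%:Z - i.+1%:Z) (vac K)).
Proof. by apply/eqP; rewrite -subr_eq0; apply/eqP/(@newton_defect_eq0 c N N). Qed.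

Section Lower.
Variables (P : pred int) (P0 : ~~ P 0).

Lemma vtx_vac c k : vtx P c k (vac K) = raise c k (vac K).
Proof.
have v0 : wtle 0%N (vac K).
  move=> m; rewrite /vac mcoeffU; have [<-|_] := eqVneq mone m; last by rewrite eqxx.
  by rewrite /wt mdom1 big_seq_fset0.
rewrite (@vtxE _ P P0 c 0 `|k| k _ v0)//; rewrite (@sum_ints1 _ _ k)//.
  by rewrite subrr (lower_vac P0) eqxx.
move=> i ik; rewrite (lower_vac P0) subr_eq0 eq_sym (negbTE ik).
exact: lin0 (raise_linear c i).
Qed.

Lemma vtx_coef1 c k v : (vtx P c k v)@_mone = (lower P (- c) k v)@_mone.
Proof.
have [d dv] := wtle_ex v; rewrite (vtxE P0 c dv (leqnn _)).
apply: (etrans (lin_sum (coef_linear (mone : mono)) _ _ _)).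
rewrite (@sum_ints1 _ _ 0)// => [|i i0]; first by rewrite raise_coef1 eqxx subr0.
by rewrite raise_coef1 (negbTE i0).
Qed.

(** The coefficient of z^a w^b in
    <0| exp(c sum_n a_n/n (...)) exp(c sum_n a_{-n}/n z^n) |0>, where (...) is
    w^{-n} or w^n + w^{-n} according to P. *)
Definition vev c (a b : int) : K := (lower P c b (raise c a (vac K)))@_mone.

Lemma vev0 c b : vev c 0 b = (b == 0)%:R.
Proof.
rewrite /vev raise0_vac (lower_vac P0); case: eqP => _; last by rewrite mcoeff0.
by rewrite mcoeffUU.
Qed.

Lemma vev_neg c a b : a < 0 -> vev c a b = 0.
Proof. by move=> a0; rewrite /vev raise_neg// (lin0 (lower_linear P0 c b)) mcoeff0. Qed.

(** Apply the Newton identity to the right factor, then commute a_{-n} to the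
    left, where <0| kills it. *)
Lemma vev_rec c (a : nat) b : c * c = 1 -> a%:R * vev c a b =
  \sum_(i < a) ((P (- i.+1%:Z))%:R * vev c (a%:Z - i.+1%:Z) (b + i.+1%:Z)
              + (P i.+1)%:R * vev c (a%:Z - i.+1%:Z) (b - i.+1%:Z)).
Proof.
move=> cc; pose L v : K^o := (lower P c b v)@_mone.
have lL : linear L.
  by move=> x u w; rewrite /L (lower_linear P0 c b x u w); exact: coef_linear.
transitivity (L (a%:R *: raise c a (vac K))); first by rewrite (linZ lL).
rewrite newton (linZ lL) (lin_sum lL) scaler_sumr; apply: eq_bigr => i _.
have i0 : Negz i != 0 by [].
have l1 := @coef_linear K (mone : mono).
have := lower_comm P0 c i0 b (raise c (a%:Z - i.+1%:Z) (vac K)).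
move/(congr1 (mcoeff (mone : mono))) => e; rewrite /L e {e}.
apply: (etrans (congr1 (fun x : K => c * x) (lin3 l1 _ _ _ _ _))).
rewrite act_coef1// add0r -[_ *: _]/(_ * _) -[X in _ + X]/(_ * _) /= -!/(vev _ _ _).
rewrite NegzE !opprK mulrDr !mulrA.
by do 2!case: ifP => _; rewrite ?cc ?mulr0 ?mul0r ?mul1r.
Qed.

End Lower.
End VacuumExpectation.

(** The supports of 1/(1 - z/w) and of 1/((1 - zw)(1 - z/w)): the coefficient of
    z^a, a >= 0, is w^{-a}, respectively w^a + w^{a-2} + ... + w^{-a}. *)
Definition on_antidiag (a b : int) : bool := b == - a.
Definition in_parity_cone (a b : int) : bool := (`|b| <= a) && (2 %| a - b)%Z.

Lemma sum_ltn (a s : nat) : (\sum_(i < a) (i < s) = minn a s)%N.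
Proof. by elim: a => [|a IH]; rewrite ?big_ord0 ?min0n// big_ord_recr/= IH; lia. Qed.

Lemma on_antidiag_rec (a : nat) b : (a * on_antidiag a b)%N =
  (\sum_(i < a) on_antidiag (a%:Z - i.+1%:Z) (b + i.+1%:Z))%N.
Proof.
rewrite (eq_bigr (fun=> nat_of_bool (on_antidiag a b))) => [|i _].
  by rewrite sum_nat_const card_ord.
by rewrite /on_antidiag; congr nat_of_bool; lia.
Qed.

(** Inside the cone, (a - b)/2 of the points (a - n, b + n) and (a + b)/2 of the
    points (a - n, b - n), 1 <= n <= a, stay inside; together they number a.
    From outside the cone none of them enters it. *)
Lemma in_parity_cone_rec (a : nat) b : (a * in_parity_cone a b)%N =
  (\sum_(i < a) (in_parity_cone (a%:Z - i.+1%:Z) (b + i.+1%:Z)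
               + in_parity_cone (a%:Z - i.+1%:Z) (b - i.+1%:Z)))%N.
Proof.
have [cab|cab] := boolP (in_parity_cone a b); last first.
  rewrite muln0 big1// => i _.
  have -> : in_parity_cone (a%:Z - i.+1%:Z) (b + i.+1%:Z) = false.
    by move: cab; rewrite /in_parity_cone; lia.
  have -> // : in_parity_cone (a%:Z - i.+1%:Z) (b - i.+1%:Z) = false.
  by move: cab; rewrite /in_parity_cone; lia.
have [s [t [sE tE]]] : exists s t : nat, a%:Z - b = 2 * s%:Z /\ a%:Z + b = 2 * t%:Z.
  move: cab; rewrite /in_parity_cone => /andP[ba /dvdzP[q qE]].
  by exists (absz q), (absz (a%:Z - q)); lia.
rewrite (eq_bigr (fun i : 'I_a => (i < s) + (i < t))%N) => [|i _]; last first.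
  by rewrite /in_parity_cone; congr (nat_of_bool _ + nat_of_bool _)%N; lia.
rewrite big_split/= !sum_ltn; lia.
Qed.

Definition vevX (a b : int) : nat := (0 <= a) && on_antidiag a b.
Definition vevY (a b : int) : nat := (0 <= a) && in_parity_cone a b.

(** At z^a, multiplication by 1 - w^2 leaves only the two ends w^{-a} and
    - w^{a+2} of w^{-a} + ... + w^a. The second pair of terms, where z and w are
    exchanged, cancels w^{a+2} and supplies w^{-a} for a < 0. *)
Lemma vevY_row a b : (vevY a b + vevY (b - 1)%R (a + 1)%R =
  (a + b == 0)%R + (vevY a (b - 2)%R + vevY (b - 1 - 2)%R (a + 1)%R))%N.
Proof.
rewrite /vevY /in_parity_cone.
have [-> -> ->] : [/\ (2 %| a - (b - 2))%Z = (2 %| a - b)%Z,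
    (2 %| b - 1 - (a + 1))%Z = (2 %| a - b)%Z
  & (2 %| b - 1 - 2 - (a + 1))%Z = (2 %| a - b)%Z] by split; lia.
have ab : a + b == 0 -> (2 %| a - b)%Z by lia.
(* every term vanishes unless a and b have the same parity *)
have [eab|eab] := boolP (2 %| a - b)%Z; last first.
  by rewrite !andbF; case: eqP ab eab => // _ /(_ isT) ->.
rewrite !andbT; lia.
Qed.

Lemma vevY_column a b : (vevY a b + vevY (b - 1)%R (a + 1)%R =
  (a + b == 0)%R + (vevY (a - 2)%R b + vevY (b - 1)%R (a + 1 - 2)%R))%N.
Proof.
rewrite /vevY /in_parity_cone.
have [-> -> ->] : [/\ (2 %| a - 2 - b)%Z = (2 %| a - b)%Z,
    (2 %| b - 1 - (a + 1))%Z = (2 %| a - b)%Z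
  & (2 %| b - 1 - (a + 1 - 2))%Z = (2 %| a - b)%Z] by split; lia.
have ab : a + b == 0 -> (2 %| a - b)%Z by lia.
(* every term vanishes unless a and b have the same parity *)
have [eab|eab] := boolP (2 %| a - b)%Z; last first.
  by rewrite !andbF; case: eqP ab eab => // _ /(_ isT) ->.
rewrite !andbT; lia.
Qed.

(** * The fermionic relation *)

Section LinearClosure.
Context (K : numFieldType) (V : lmodType K).
Implicit Types f g : V -> V.

Lemma lin_comp f g : linear f -> linear g -> linear (fun v => f (g v)).
Proof. by move=> lf lg x u v; rewrite lg lf. Qed.

Lemma lin_add f g : linear f -> linear g -> linear (fun v => f v + g v).
Proof. by move=> lf lg x u v; rewrite lg lf scalerDr addrACA. Qed.

Lemma lin_sub f g : linear f -> linear g -> linear (fun v => f v - g v).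
Proof. by move=> lf lg x u v; rewrite lg lf scalerBr opprD addrACA. Qed.

Lemma lin_scale x : linear (fun v : V => x *: v).
Proof. by move=> y u v; rewrite scalerDr !scalerA mulrC. Qed.

Lemma lin_mul1z2 (T : opser V) :
  (forall k, linear (T k)) -> forall k, linear (mul1z2 T k).
Proof. by move=> lT k; apply: lin_sub. Qed.
End LinearClosure.

Section Relations.
Context (K : numFieldType).
Implicit Types (c : K).

(** The recursion of vev_rec and the value at a = 0 determine the family. *)
Lemma vev_chi (P : pred int) (P0 : ~~ P 0) (chi : int -> int -> bool) c :
  c * c = 1 -> (forall b, chi 0 b = (b == 0)) ->
  (forall (a : nat) b, (a * chi a b)%N = (\sum_(i < a)
     (P (- i.+1%:Z)%R * chi (a%:Z - i.+1%:Z)%R (b + i.+1%:Z)%R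
      + P i.+1%:Z * chi (a%:Z - i.+1%:Z)%R (b - i.+1%:Z)%R))%N) ->
  forall a b, vev P c a b = ((0 <= a) && chi a b)%:R.
Proof.
move=> cc chi0 chiS [a|a] b; last exact: vev_neg.
rewrite lez_nat /=; have [n] := ubnP a; elim: n a b => // n IH [|a] b an.
  by rewrite vev0// chi0.
have a0 : (a.+1%:R : K) != 0 by rewrite pnatr_eq0.
apply: (mulfI a0); rewrite vev_rec// -natrM chiS natr_sum.
apply: eq_bigr => i _; rewrite natrD !natrM.
have -> : a.+1%:Z - i.+1%:Z = (a - i)%N%:Z by have := ltn_ord i; lia.
by rewrite !IH//; lia.
Qed.

Lemma vev_negE c a b : c * c = 1 -> vev (fun k => k < 0) c a b = (vevX a b)%:R.
Proof.
move=> cc; apply: vev_chi => // {}a {}b.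
rewrite on_antidiag_rec; apply: eq_bigr => i _.
by rewrite mul0n addn0 mul1n.
Qed.

Lemma vev_nzE c a b : c * c = 1 -> vev (fun k => k != 0) c a b = (vevY a b)%:R.
Proof.
move=> cc; apply: vev_chi => // [i|{}a {}b]; first by rewrite /in_parity_cone; lia.
by rewrite in_parity_cone_rec; apply: eq_bigr => i _; rewrite !mul1n.
Qed.

(** The difference of the two sides falls under birel_eq0. *)
Lemma anticommutation T T' (p q : int -> K) :
  (forall k, linear (T k)) -> (forall k, linear (T' k)) ->
  (forall n, n != 0 -> comrel (@act K n) T n (p n) (q n)) ->
  (forall n, n != 0 -> comrel (@act K n) T' n (- p n) (- q n)) ->
  (forall a b, (T' b (T a (vac K)))@_mone + (T (a + 1) (T' (b - 1) (vac K)))@_mone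
     = (a + b == 0)%:R) ->
  forall a b v, T' b (T a v) + T (a + 1) (T' (b - 1) v) = (a + b == 0)%:R *: v.
Proof.
move=> lT lT' cT cT' vac1 a b v; apply/eqP; rewrite -subr_eq0; apply/eqP.
pose F a b v := T' b (T a v) + T (a + 1) (T' (b - 1) v) - (a + b == 0)%:R *: v.
apply: (@birel_eq0 K F p q) => [{}a {}b|n n0|{}a {}b].
- apply: lin_sub; last exact: lin_scale.
  apply: lin_add; first exact: (lin_comp (lT' b) (lT a)).
  exact: (lin_comp (lT (a + 1)) (lT' (b - 1))).
- apply: birelD; first exact: act_linear; last first.
    by apply: birelN; [exact: act_linear|apply: birel_delta; exact: act_linear].
  by apply: birelD; [exact: act_linear|exact: (birel_mul lT' (cT n n0) (cT' n n0))
    |exact: (birel_mulC lT (cT n n0) (cT' n n0))].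
- have l1 := @coef_linear K (mone : mono).
  apply: (etrans (linB l1 _ _)).
  apply: (etrans (congr2 (fun x y : K => x - y) (linD l1 _ _) (linZ l1 _ _))).
  by rewrite /= vac1 mcoeffUU -[_ *: _]/(_ * _) mulr1 subrr.
Qed.

End Relations.

Section VertexRelations.
Context (K : numFieldType).

(** The scalars p and q in the commutator of X(z) or Y(z) with a_n. For n > 0
    the creation part gives p = -1. For n < 0 the annihilation part gives p = -1,
    and also q = -1 when it contains positive powers of z. *)
Definition shift_down (P : pred int) (n : int) : K := - ((0 < n) || P n)%:R.
Definition shift_up (P : pred int) (n : int) : K := - ((n < 0) && P (- n))%:R.

Lemma vtx_comm (P : pred int) c n : ~~ P 0 -> n != 0 ->
  comrel (@act K n) (vtx P c) n (c * shift_down P n) (c * shift_up P n).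
Proof.
move=> P0 n0.
have := vtx_comrel P0 (act_linear n) (raise_comm c n0) (lower_comm P0 (- c) n0).
rewrite /shift_down /shift_up add0r.
have -> : (if (n < 0) && P (- n) then - c else 0) = c * - ((n < 0) && P (- n))%:R.
  by case: (_ && _); rewrite ?oppr0 ?mulr0 ?mulrN1.
suff -> : (if 0 < n then - c else 0) + (if (n < 0) && P n then - c else 0)
    = c * - ((0 < n) || P n)%:R by [].
have [n1|n1|n1] := ltgtP n 0; last by rewrite n1 eqxx in n0.
  by rewrite add0r /=; case: (P n); rewrite ?oppr0 ?mulr0 ?mulrN1.
by rewrite /= addr0 mulrN1.
Qed.

Lemma vtx_vev (P : pred int) c a b : ~~ P 0 ->
  (vtx P (- c) b (vtx P c a (vac K)))@_mone = vev P c a b.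
Proof. by move=> P0; rewrite vtx_vac// vtx_coef1// opprK. Qed.

Lemma vtx_anticommutation (P : pred int) (T T' : opser (fock K)) :
  ~~ P 0 ->
  (T = vtx P 1 \/ T = mul1z2 (vtx P 1)) ->
  (T' = vtx P (- 1) \/ T' = mul1z2 (vtx P (- 1))) ->
  (forall a b, (T' b (T a (vac K)))@_mone + (T (a + 1) (T' (b - 1) (vac K)))@_mone
     = (a + b == 0)%:R) ->
  forall a b v, T' b (T a v) + T (a + 1) (T' (b - 1) v) = (a + b == 0)%:R *: v.
Proof.
move=> P0 TE T'E; apply: (anticommutation (p := shift_down P) (q := shift_up P)).
- by case: TE => -> k; [|apply: lin_mul1z2 => {}k]; exact: vtx_linear.
- by case: T'E => -> k; [|apply: lin_mul1z2 => {}k]; exact: vtx_linear.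
- move=> n n0; have := @vtx_comm P 1 n P0 n0; rewrite !mul1r => cT.
  case: TE => ->; [exact: cT|exact: (comrel_mul1z2 (act_linear n) cT)].
- move=> n n0; have := @vtx_comm P (- 1) n P0 n0; rewrite !mulN1r => cT.
  case: T'E => ->; [exact: cT|exact: (comrel_mul1z2 (act_linear n) cT)].
Qed.

Lemma natr_diff (x y z w d : nat) : (x + z = d + (y + w))%N ->
  x%:R - y%:R + (z%:R - w%:R) = d%:R :> K.
Proof.
by move/(congr1 (fun n => n%:R : K)); rewrite !natrD addrACA -opprD => ->; rewrite addrK.
Qed.

Let neg (k : int) := k < 0.
Let nz (k : int) := k != 0.

(** On vacuum expectation values:
    1/(1 - z/w) + (w/z)/(1 - w/z) = delta(z/w). *)
Lemma X_anticomm a b v :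
  vtx neg (- 1) b (vtx neg 1 a v) + vtx neg 1 (a + 1) (vtx neg (- 1) (b - 1) v)
  = (a + b == 0)%:R *: v :> fock K.
Proof.
apply: (@vtx_anticommutation neg (vtx neg 1) (vtx neg (- 1)));
  [by []|by left|by left|move=> {}a {}b].
(* the left factor is vtx neg (- c) for c = - 1 *)
rewrite vtx_vev// -[X in vtx _ X (a + 1)]opprK vtx_vev// !vev_negE ?mulrNN ?mulr1//.
by rewrite -natrD /vevX /on_antidiag; congr (_%:R); lia.
Qed.

(** On vacuum expectation values, by partial fractions,
    (1 - w^2)/((1 - zw)(1 - z/w)) = 1/(1 - z/w) - w^2/(1 - zw) and
    (w/z)(1 - w^2)/((1 - zw)(1 - w/z)) = (w/z)/(1 - w/z) + w^2/(1 - zw). *)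
Lemma Y_anticomm a b v :
  mul1z2 (vtx nz (- 1)) b (vtx nz 1 a v)
  + vtx nz 1 (a + 1) (mul1z2 (vtx nz (- 1)) (b - 1) v)
  = (a + b == 0)%:R *: v :> fock K.
Proof.
apply: (@vtx_anticommutation nz (vtx nz 1) (mul1z2 (vtx nz (- 1))));
  [by []|by left|by right|move=> {}a {}b].
have l1 := @coef_linear K (mone : mono).
have e1 := linB l1 (vtx nz (- 1) b (vtx nz 1 a (vac K)))
  (vtx nz (- 1) (b - 2) (vtx nz 1 a (vac K))).
have e2 := linB l1 (vtx nz 1 (a + 1) (vtx nz (- 1) (b - 1) (vac K)))
  (vtx nz 1 (a + 1) (vtx nz (- 1) (b - 1 - 2) (vac K))).
rewrite /mul1z2 (linB (vtx_linear _ _ _))// e1 e2.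
rewrite !vtx_vev// -[X in vtx _ X (a + 1)]opprK !vtx_vev//.
rewrite !vev_nzE ?mulrNN ?mulr1//; apply: natr_diff; exact: vevY_row.
Qed.

(** On vacuum expectation values, by partial fractions,
    (1 - z^2)/((1 - zw)(1 - z/w)) = 1/(1 - z/w) + zw/(1 - zw) and
    (w/z)(1 - z^2)/((1 - zw)(1 - w/z)) = (w/z)/(1 - w/z) - zw/(1 - zw). *)
Lemma W_anticomm a b v :
  vtx nz (- 1) b (mul1z2 (vtx nz 1) a v)
  + mul1z2 (vtx nz 1) (a + 1) (vtx nz (- 1) (b - 1) v)
  = (a + b == 0)%:R *: v :> fock K.
Proof.
apply: (@vtx_anticommutation nz (mul1z2 (vtx nz 1)) (vtx nz (- 1)));
  [by []|by right|by left|move=> {}a {}b].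
have l1 := @coef_linear K (mone : mono).
have e1 := linB l1 (vtx nz (- 1) b (vtx nz 1 a (vac K)))
  (vtx nz (- 1) b (vtx nz 1 (a - 2) (vac K))).
have e2 := linB l1 (vtx nz 1 (a + 1) (vtx nz (- 1) (b - 1) (vac K)))
  (vtx nz 1 (a + 1 - 2) (vtx nz (- 1) (b - 1) (vac K))).
rewrite /mul1z2 (linB (vtx_linear _ _ _))// e1 e2.
rewrite !vtx_vev// -[X in vtx _ X (a + 1)]opprK -[X in vtx _ X (a + 1 - 2)]opprK.
rewrite !vtx_vev// !vev_nzE ?mulrNN ?mulr1//; apply: natr_diff; exact: vevY_column.
Qed.

End VertexRelations.

(** * Adjoints for the pairing *)

Section Pairing.
Context (K : numFieldType).
Implicit Types (u : dualmod K) (v : fock K).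

Lemma pairing_widen u v (d : {fset mono}) : (msupp v `<=` d)%fset ->
  pairing u v = \sum_(m <- d)
    u m * v@_m * (\prod_(k <- finsupp m) (k.+1 ^ m k * (m k)`!))%:R.
Proof.
move=> vd; rewrite /pairing (big_fset_incl _ vd)// => m _ mv.
by rewrite mcoeff_outdom// mulr0 mul0r.
Qed.

Lemma pairing_linear u : linear (pairing u : fock K -> K^o).
Proof.
move=> a v w; pose d := (msupp (a *: v + w) `|` (msupp v `|` msupp w))%fset.
rewrite (@pairing_widen u _ d) ?fsubsetUl// (@pairing_widen u v d); last first.
  by rewrite fsubsetU// fsubsetUl orbT.
rewrite (@pairing_widen u w d); last by rewrite fsubsetU// fsubsetUr orbT.
rewrite scaler_sumr -big_split/=; apply: eq_bigr => m _.
rewrite -[RHS]/(a * _ + _); have -> : (a *: v + w)@_m = a * v@_m + w@_m.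
  exact: coef_linear.
by ring.
Qed.

Lemma pairing_linearl v : linear (fun u : dualmod K => pairing u v : K^o).
Proof.
move=> a u w; rewrite /pairing scaler_sumr -big_split/=; apply: eq_bigr => m _.
rewrite -[RHS]/(a * _ + _) -[(a *: u + w) m]/(a * u m + w m).
by ring.
Qed.

Lemma eq_pairing u u' v : (forall m, m \in msupp v -> u m = u' m) ->
  pairing u v = pairing u' v.
Proof.
by move=> uu; rewrite /pairing; apply: eq_big_seq => m /uu ->.
Qed.

Section Adjoint.
Variables (B' : int -> dualmod K -> dualmod K) (B : int -> fock K -> fock K).
Hypotheses (lB' : forall i, linear (B' i)) (lB : forall i, linear (B i)).
Hypothesis adj : forall k u v, pairing (B' k u) v = pairing u (B k v).

Lemma powser_adjoint d n k u v :
  pairing (powser B' d n k u) v = pairing u (powser B d n k v).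
Proof.
elim: n k u v => [|n IH] k u v.
  rewrite /=; case: ifP => // _.
  by rewrite (lin0 (pairing_linear u)); exact: (lin0 (pairing_linearl v)).
rewrite (powserSr lB) (lin_sum (pairing_linear u)).
apply: (etrans (lin_sum (pairing_linearl v) _ _ _)); apply: eq_bigr => i _.
by rewrite adj IH.
Qed.

Lemma texp_adjoint d N k u v :
  pairing (texp B' d N k u) v = pairing u (texp B d N k v).
Proof.
rewrite /texp (lin_sum (pairing_linear u)).
apply: (etrans (lin_sum (pairing_linearl v) _ _ _)); apply: eq_bigr => i _.
rewrite (linZ (pairing_linear u)); apply: (etrans (linZ (pairing_linearl v) _ _)).
by rewrite powser_adjoint.
Qed.

Lemma expser_adjoint k u v d :
  bounded B k v d ->
  (forall m s, m \in msupp v -> \sum_(i <- s) i = k -> foldr B' u s m != 0 ->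
     small d s) ->
  pairing (expser (V := dualmod K) (@cfsum K) B' k u) v
  = pairing u (expser (@fsum K) B k v).
Proof.
move=> bd bd'; rewrite (expserE lB bd (ltnSn d)) -texp_adjoint.
apply: eq_pairing => m mv; apply: (cexpserE lB' _ (ltnSn d)) => s.
exact: bd'.
Qed.
End Adjoint.

(** The degree filtration of the completed dual, which a_n shifts up by n; it
    bounds the words that contribute at a given monomial. *)
Definition vanish_below (e : int) u := forall m, (wt m)%:Z < e -> u m = 0.

Lemma vanish_ract n e u : vanish_below e u -> vanish_below (e + n) (ract n u).
Proof.
move=> ue m; case: n => [[|k]|k] //=.
  case: ifP => // /negbT mk wm; apply: ue.
  by move: wm; rewrite -{1}(mulDU mk) wt_mulU; lia.
by move=> wm; rewrite ue ?mulr0// wt_mulU; lia.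
Qed.

Lemma annser_ract_normsum P c u s m :
  foldr (annser (@ract K : int -> dualmod K -> dualmod K) P c) u s m != 0 ->
  (normsum s <= wt m)%N.
Proof.
apply: contraR => ms; apply/eqP; move: m ms.
suff H : vanish_below (normsum s)%:Z
    (foldr (annser (@ract K : int -> dualmod K -> dualmod K) P c) u s).
  by move=> m; rewrite -ltnNge => ms; apply: H.
rewrite /normsum; elim: s => [|x s IH]; first by move=> m; rewrite big_nil.
rewrite big_cons PoszD addrC /= {1}/annser => m ms; case: ifP => // _.
by rewrite -[LHS]/(_ * _) (vanish_ract IH) ?mulr0.
Qed.

End Pairing.

Section VertexAdjoint.
Context (K : numFieldType).
Implicit Types (u : dualmod K) (v : fock K).
Local Notation ra := (@ract K : int -> dualmod K -> dualmod K).

(** vtx with the right action on the dual, the creation part acting first. *)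
Definition rvtx (P : pred int) (c : K) : opser (dualmod K) :=
  rmulser (@cfsum K) (expser (V := dualmod K) (@cfsum K) (crexp ra c))
                     (expser (V := dualmod K) (@cfsum K) (annser ra P (- c))).

Lemma pairing0l v : pairing (0 : dualmod K) v = 0.
Proof. exact: (lin0 (pairing_linearl v)). Qed.

Lemma scale_act_adjoint (x : K) n u v :
  pairing (x *: ra n u) v = pairing u (x *: act n v).
Proof.
rewrite (linZ (pairing_linear u)) -pairing_act.
exact: (linZ (pairing_linearl v)).
Qed.

Lemma raise_adjoint c k u v :
  pairing (expser (V := dualmod K) (@cfsum K) (crexp ra c) k u) v
  = pairing u (raise c k v).
Proof.
rewrite raise.unlock; apply: (@expser_adjoint K _ _ _ _ _ k u v `|k|).
- exact: (crexp_linear (@ract_linear K)).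
- exact: (crexp_linear (@act_linear K)).
- move=> j w t; rewrite /crexp; case: (0 < j); first exact: scale_act_adjoint.
  by rewrite pairing0l (lin0 (pairing_linear w)).
- exact: crexp_bounded.
- move=> m s _ sk f0; apply: (crexp_small (@ract_linear K) sk (v := u) (c := c)).
  by apply: contraNneq f0 => ->.
Qed.

Section Lower.
Variables (P : pred int) (P0 : ~~ P 0).

Lemma wt_msupp (d : nat) v m : wtle d v -> m \in msupp v -> (wt m <= d)%N.
Proof. by move=> dv; rewrite -mcoeff_neq0 => /dv; lia. Qed.

Lemma annser_ract_small c u s m (d : nat) : (wt m <= d)%N ->
  foldr (annser ra P c) u s m != 0 -> small d s.
Proof.
move=> md f0; have sd := leq_trans (annser_ract_normsum f0) md.
apply: small_le sd _; apply: small_normsum.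
apply: (annser_nz P0 (@ract_linear K) (v := u) (c := c)).
by apply: contraNneq f0 => ->.
Qed.

Lemma lower_adjoint c k u v :
  pairing (expser (V := dualmod K) (@cfsum K) (annser ra P c) k u) v
  = pairing u (lower P c k v).
Proof.
have [d dv] := wtle_ex v.
rewrite lower.unlock; apply: (@expser_adjoint K _ _ _ _ _ k u v d).
- exact: (annser_linear (@ract_linear K)).
- exact: (annser_linear (@act_linear K)).
- move=> j w t; rewrite /annser; case: (P j); first exact: scale_act_adjoint.
  by rewrite pairing0l (lin0 (pairing_linear w)).
- exact: annser_bounded.
- by move=> m s mv _; apply: annser_ract_small; exact: wt_msupp mv.
Qed.

Lemma rlower_big c k u m :
  expser (V := dualmod K) (@cfsum K) (annser ra P c) k u m != 0 ->
  (`|k| <= wt m)%N.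
Proof.
apply: contraR => mk.
have lB := annser_linear (@ract_linear K) P c.
rewrite (cexpserE lB (d := wt m) (N := (wt m).+1))//; last first.
  by move=> s _; exact: annser_ract_small.
rewrite texp_words//; apply/eqP.
have lm : linear (fun w : dualmod K => w m : K^o) by [].
rewrite (lin_sum lm) big1// => n _; rewrite (lin_sum lm) big1// => s /eqP sk.
rewrite -[LHS]/(_ * _); apply/eqP; rewrite mulf_eq0; apply/orP; right.
apply: contraTT mk => /annser_ract_normsum.
by have := normsum_ge s; rewrite sk; lia.
Qed.

Lemma rvtx_adjoint c k u v : pairing (rvtx P c k u) v = pairing u (vtx P c k v).
Proof.
have [d dv] := wtle_ex v; pose D := (d + `|k|)%N.
rewrite (vtxE P0 c dv (leqnn _)) -/D (lin_sum (pairing_linear u)).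
pose A i := expser (V := dualmod K) (@cfsum K) (crexp ra c) i u.
pose B i := expser (V := dualmod K) (@cfsum K) (annser ra P (- c)) (k - i).
transitivity (pairing (\sum_(i <- ints D) B i (A i) : dualmod K) v).
  apply: eq_pairing => m mv.
  have lm : linear (fun w : dualmod K => w m : K^o) by [].
  rewrite (lin_sum lm); apply: (@sum_ints_fs K D (fun i => B i (A i) m)) => i.
  by move/rlower_big; have := wt_msupp dv mv; rewrite /D; lia.
apply: (etrans (lin_sum (pairing_linearl v) _ _ _)); apply: eq_bigr => i _.
by rewrite /B lower_adjoint raise_adjoint.
Qed.

Lemma rvtx_mul1z2_adjoint c k u v :
  pairing (mul1z2 (rvtx P c) k u) v = pairing u (mul1z2 (vtx P c) k v).
Proof.
rewrite /mul1z2 (linB (pairing_linear u)) -!rvtx_adjoint.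
exact: (linB (pairing_linearl v)).
Qed.

End Lower.
End VertexAdjoint.

(** * Orthonormality from the fermionic relation *)

Section Fermions.
Context (K : numFieldType) (T T' : opser (fock K)) (U : opser (cfock K)).
Hypotheses (lT : forall k, linear (T k))
  (rel : forall a b v,
     T' b (T a v) + T (a + 1) (T' (b - 1) v) = (a + b == 0)%:R *: v)
  (T'vac : forall b, b < 0 -> T' b (vac K) = 0)
  (adj : forall k u v, pairing (U k u) v = pairing u (T' k v)).

Local Notation state s := (foldr (fun (p : nat) v => T p%:Z v) (vac K) s).
Local Notation costate s :=
  (foldr (fun (p : nat) u => U (- p%:Z) u) (covac K) s).

Lemma hop (q x : nat) v : T' (- q%:Z) (T x%:Z v) =
  (x == q)%:R *: v - T x.+1%:Z (T' (- q.+1%:Z) v).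
Proof.
have := rel x%:Z (- q%:Z) v; rewrite subr_eq0 eqz_nat => <-.
rewrite (_ : x%:Z + 1 = x.+1%:Z); last by lia.
by rewrite (_ : - q%:Z - 1 = - q.+1%:Z) ?addrK//; lia.
Qed.

Lemma foldr_linear (s : seq nat) :
  linear (fun v => foldr (fun (p : nat) v => T p%:Z v) v s).
Proof. by elim: s => [|p s IH] a u v //=; rewrite IH lT. Qed.

(** T'_{-q-1} has already passed the parts in pre, at least one of them, each
    raised by 1, and lam is still to be passed. If it is absorbed by a part
    x = q + 1 of lam, the first part of pre exceeds x, hence also the first
    part of mu, and L vanishes on the ket left over. Otherwise it reaches the
    vacuum and kills it. *)
Lemma commute_past (L : fock K -> K^o) (mu : seq nat) : linear L ->
  (forall s, pairwise geq s -> size s = size mu -> s != mu -> L (state s) = 0) ->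
  forall lam pre q, pairwise geq pre -> pairwise geq lam -> allrel gtn pre lam ->
  pre != [::] -> (head 0 mu <= q)%N -> (size pre + size lam = (size mu).+1)%N ->
  L (foldr (fun (p : nat) v => T p%:Z v) (T' (- q.+1%:Z) (state lam)) pre) = 0.
Proof.
move=> lL L0; elim=> [|x lam IH] pre q spre slam gt pre0 muq sz.
  by rewrite T'vac// (lin0 (foldr_linear _)) (lin0 lL).
have -> : state (x :: lam) = T x%:Z (state lam) by [].
rewrite hop (linB (foldr_linear pre)) (linB lL) (linZ (foldr_linear pre)) (linZ lL).
move: slam; rewrite /= => /andP[xlam slam].
move: gt; rewrite allrel_consr => /andP[prex gt].
have -> : foldr (fun (p : nat) v => T p%:Z v)
    (T x.+1%:Z (T' (- q.+2%:Z) (state lam))) pre =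
    foldr (fun (p : nat) v => T p%:Z v) (T' (- q.+2%:Z) (state lam)) (rcons pre x.+1).
  by rewrite foldr_rcons.
rewrite IH ?subr0//; last 1 first.
- by move: sz; rewrite size_rcons /=; lia.
(* absorption: pre ++ lam is a weakly decreasing word other than mu *)
- have [xq|_] := eqVneq x q.+1; last by rewrite scale0r.
  rewrite scale1r -foldr_cat; apply: L0.
  + rewrite pairwise_cat spre slam !andbT.
    by apply: sub_allrel gt => y z /ltnW.
  + by move: sz; rewrite size_cat /=; lia.
  + case: pre pre0 prex {IH spre gt sz} => // y pre _ /= /andP[xy _].
    by apply: contraTneq muq => <- /=; rewrite -ltnNge; lia.
- rewrite -cats1 pairwise_cat spre /= andbT allrel1r.
  by rewrite (eq_all (a2 := (gtn^~ x)))//.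
- rewrite -cats1 allrel_catl gt /= allrel1l.
  by apply: sub_all xlam => y.
- by case: (pre).
- exact: leq_trans muq _.
Qed.

Lemma orthonormal mu lam : pairwise geq mu -> pairwise geq lam ->
  size lam = size mu -> pairing (costate mu) (state lam) = (lam == mu)%:R.
Proof.
elim: mu lam => [|p mu IH] [|x lam]//=; first by rewrite pairing_vac.
move=> /andP[pmu smu] /andP[xlam slam] [sz].
rewrite adj; pose L := pairing (costate mu) : fock K -> K^o.
have lL : linear L by exact: (pairing_linear (costate mu : dualmod K)).
rewrite -/(L _).
rewrite hop (linB lL) (linZ lL) -[T _ _]/(foldr (fun (p : nat) v => T p%:Z v)
  (T' (- p.+1%:Z) (state lam)) [:: x.+1]).
rewrite (@commute_past L mu)// ?subr0.
- by rewrite /L IH// -[LHS]/(_ * _) -natrM mulnb eqseq_cons.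
- by move=> s ss sm smu'; rewrite /L IH// (negbTE smu').
- by rewrite allrel1l; apply: sub_all xlam => y.
- by case: (mu) pmu => [|y t] //= /andP[].
- by rewrite sz.
Qed.

End Fermions.

(** * The three families *)

Section Families.
Context (K : numFieldType).
Let neg (k : int) := k < 0.
Let nz (k : int) := k != 0.

Lemma XserE : Xser (K := K) = vtx neg 1.
Proof. by rewrite vtx.unlock raise.unlock lower.unlock /Xser anexpE. Qed.

Lemma XsserE : Xsser (K := K) = rvtx neg (- 1).
Proof.
by rewrite /rvtx opprK /Xsser (@anexpE K (dualmod K) (@ract K)).
Qed.

Lemma YserE : Yser (K := K) = vtx nz 1.
Proof. by rewrite vtx.unlock raise.unlock lower.unlock. Qed.

Lemma YsserE : Ysser (K := K) = mul1z2 (rvtx nz (- 1)).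
Proof. by rewrite /rvtx opprK. Qed.

Lemma WserE : Wser (K := K) = mul1z2 (vtx nz 1).
Proof. by rewrite vtx.unlock raise.unlock lower.unlock. Qed.

Lemma WsserE : Wsser (K := K) = rvtx nz (- 1).
Proof. by rewrite /rvtx opprK. Qed.

Lemma ketE (T : opser (fock K)) s : ket (fun n => T (- n)) s =
  foldr (fun (p : nat) v => T p%:Z v) (vac K) s.
Proof. by elim: s => //= p s ->; rewrite opprK. Qed.

Lemma vtx_vac_neg (P : pred int) (c : K) b : ~~ P 0 -> b < 0 ->
  vtx P c b (vac K) = 0.
Proof. by move=> P0 b0; rewrite vtx_vac// raise_neg. Qed.

Lemma braX_ketX mu lam : sorted geq mu -> sorted geq lam -> size lam = size mu ->
  pairing (braX K mu) (ketX K lam) = (lam == mu)%:R.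
Proof.
rewrite !(sorted_pairwise (rev_trans leq_trans)) => smu slam sz.
rewrite /ketX /Xop ketE XserE /braX /bra /Xsop XsserE.
apply: (@orthonormal K (vtx neg 1) (vtx neg (- 1)) (rvtx neg (- 1))) => //.
- by move=> k; exact: vtx_linear.
- exact: X_anticomm.
- by move=> b; exact: vtx_vac_neg.
- by move=> k u v; exact: rvtx_adjoint.
Qed.

Lemma braSp_ketSp mu lam : sorted geq mu -> sorted geq lam -> size lam = size mu ->
  pairing (braSp K mu) (ketSp K lam) = (lam == mu)%:R.
Proof.
rewrite !(sorted_pairwise (rev_trans leq_trans)) => smu slam sz.
rewrite /ketSp /Yop ketE YserE /braSp /bra /Ysop YsserE.
apply: (@orthonormal K (vtx nz 1) (mul1z2 (vtx nz (- 1)))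
  (mul1z2 (rvtx nz (- 1)))) => //.
- by move=> k; exact: vtx_linear.
- exact: Y_anticomm.
- by move=> b b0; rewrite /mul1z2 !vtx_vac_neg ?subr0//; lia.
- by move=> k u v; exact: rvtx_mul1z2_adjoint.
Qed.

Lemma braO_ketO mu lam : sorted geq mu -> sorted geq lam -> size lam = size mu ->
  pairing (braO K mu) (ketO K lam) = (lam == mu)%:R.
Proof.
rewrite !(sorted_pairwise (rev_trans leq_trans)) => smu slam sz.
rewrite /ketO /Wop ketE WserE /braO /bra /Wsop WsserE.
apply: (@orthonormal K (mul1z2 (vtx nz 1)) (vtx nz (- 1)) (rvtx nz (- 1))) => //.
- by move=> k; apply: lin_mul1z2 => {}k; exact: vtx_linear.
- exact: W_anticomm.
- by move=> b; exact: vtx_vac_neg.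
- by move=> k u v; exact: rvtx_adjoint.
Qed.

End Families.

Theorem theorem2p3 (R : realType) (l : nat) (hl : (1 <= l)%N) :
  [/\ forall mu lam : l.-tuple nat, is_part mu -> is_part lam ->
        pairing (braX R[i]%C mu) (ketX R[i]%C lam) = ((lam == mu)%:R)%R,
      forall mu lam : l.-tuple nat, is_genpart mu -> is_genpart lam ->
        pairing (braSp R[i]%C mu) (ketSp R[i]%C lam) = ((lam == mu)%:R)%R
    & forall mu lam : l.-tuple nat, is_genpart mu -> is_genpart lam ->
        pairing (braO R[i]%C mu) (ketO R[i]%C lam) = ((lam == mu)%:R)%R].
Proof.
split=> mu lam.
- by move=> /andP[smu _] /andP[slam _]; rewrite braX_ketX ?size_tuple.
- by move=> smu slam; rewrite braSp_ketSp ?size_tuple.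
- by move=> smu slam; rewrite braO_ketO ?size_tuple.
Qed.
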